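(* Let $\mathcal M$ be a countable MDP with initial state $s_0$, let $\{A_i\}_{i\in\mathbb N}$ be a sequence of sets of transitions of $\mathcal M$ that is monotone decreasing with respect to set inclusion, and consider the objective $\varphi=\bigcap_{i\in\mathbb N}\mathsf F\mathsf G A_i$. For every $\varepsilon>0$, an $\varepsilon$-optimal strategy for $\varphi$ from $s_0$ can be chosen (1) memoryless deterministic (MD), if $\mathcal M$ is universally transient; (2) deterministic Markov (Det(SC)) in general (even if $\mathcal M$ is not universally transient).
   Context: An MDP $\mathcal M$ consists of a countable set $S$ of states partitioned into controlled states $S_C$ and random states $S_R$; a transition relation $\longrightarrow\subseteq S\times S$ such that every state has at least one successor (the set $\mathrm{Succ}(s)$ of successors of $s$ may be infinite); and a function $P$ assigning to each random state $s$ a probability distribution on $\mathrm{Succ}(s)$. A run is an infinite sequence $s_0e_0s_1e_1\cdots$ with $e_i=(s_i,s_{i+1})\in\longrightarrow$; a history is a finite prefix of a run ending in a controlled state. A (general) strategy $\sigma$ maps each history ending in $s$ to a probability distribution on $\mathrm{Succ}(s)$. It is deterministic if all these distributions are Dirac; memoryless if they depend only on the current state; Markov if they depend only on the current state and the number of steps taken so far. A strategy and a start state $s$ induce a probability measure $\mathcal P_{\mathcal M,s,\sigma}$ on the Borel $\sigma$-algebra of runs from $s$. For an event $\varphi$, $\mathrm{val}(s)=\sup_\sigma\mathcal P_{\mathcal M,s,\sigma}(\varphi)$ over all strategies; $\sigma$ is $\varepsilon$-optimal for $\varphi$ from $s$ if $\mathcal P_{\mathcal M,s,\sigma}(\varphi)\ge\mathrm{val}(s)-\varepsilon$.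 $\mathsf F\mathsf G A$ is the set of runs all but finitely many of whose transitions are in $A$. $\mathcal M$ is universally transient if for every start state and every strategy, almost every run visits no state infinitely often. *)

(* Defs.v *)
From HB Require Import structures.
From mathcomp Require Import all_boot all_order all_algebra.
From mathcomp Require Import all_classical all_reals all_analysis.

Set Implicit Arguments.
Unset Strict Implicit.
Unset Printing Implicit Defensive.
Import Order.TTheory GRing.Theory Num.Theory.

Local Open Scope classical_set_scope.
Local Open Scope ring_scope.

Definition is_distr (R : realType) (S : countType) (D : pred S) (p : S -> R) :=
  [/\ forall t, 0 <= p t,
      forall t, ~~ D t -> p t = 0 &
      (\esum_(t in [set: S]) (p t)%:E = 1)%E].

(* Only the values of [prob] at random (that is, non-controlled) states matter. *)
Record mdp (R : realType) (S : countType) := MDP {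
  controlled : pred S;
  step : rel S;
  step_total : forall s, exists t, step s t;
  prob : S -> S -> R;
  probP : forall s, ~~ controlled s -> is_distr (step s) (prob s) }.

Section Definitions.
Context (R : realType) (S : countType) (M : mdp R S).

Definition transitions : set (S * S) := [set e | step M e.1 e.2].

(* A run is given by its sequence of states, which determines its transitions. *)
Definition is_run (r : nat -> S) := forall n, step M (r n) (r n.+1).

(* The history visiting the states of [rcons h s]; as every state has a
   successor, the finite paths are exactly the finite prefixes of runs. *)
Definition is_history (h : seq S) (s : S) :=
  sorted (step M) (rcons h s) && controlled M s.

(* The values of [play] outside histories are irrelevant. *)
Record strategy := Strategy {
  play :> seq S -> S -> S -> R;
  playP : forall h s, is_history h s -> is_distr (step M s) (play h s) }.

Definition deterministic_strategy (sigma : strategy) :=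
  forall h s, is_history h s -> exists u, forall t, sigma h s t = (t == u)%:R.

Definition memoryless_strategy (sigma : strategy) :=
  forall h h' s, is_history h s -> is_history h' s -> sigma h s = sigma h' s.

Definition markov_strategy (sigma : strategy) :=
  forall h h' s, is_history h s -> is_history h' s -> size h = size h' ->
    sigma h s = sigma h' s.

Definition next_prob (sigma : strategy) (h : seq S) (s t : S) : R :=
  if controlled M s then sigma h s t else prob M s t.

(* The probability that the states visited after [rcons h s] are those of [w]. *)
Fixpoint path_prob (sigma : strategy) (h : seq S) (s : S) (w : seq S) : R :=
  if w is t :: w' then
    next_prob sigma h s t * path_prob sigma (rcons h s) t w'
  else 1.

End Definitions.

(* The sequences of states, as the sample space for the start state [s]; the
   measures below are concentrated on the runs from [s]. The index [s] only
   serves to make the type pointed. *)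
Definition paths (S : countType) (s : S) : Type := nat -> S.

HB.instance Definition _ (S : countType) (s : S) := gen_eqMixin (paths s).
HB.instance Definition _ (S : countType) (s : S) := gen_choiceMixin (paths s).
HB.instance Definition _ (S : countType) (s : S) :=
  isPointed.Build (paths s) (fun=> s).

Definition cylinder (S : countType) (s : S) (p : seq S) : set (paths s) :=
  [set r | mkseq r (size p) = p].
Arguments cylinder {S} s p.

(* As S is discrete and countable, the cylinders generate the Borel sets of the
   product topology on sequences. *)
Notation path_space s := (g_sigma_algebraType (range (cylinder s))).

(* Existence of the measure with prescribed transition kernels: the law, under
   Lebesgue measure on [0, 1), of a sequence of states obtained by repeatedly
   splitting an interval in proportion to the kernel. *)
Section IonescuTulcea.
Context (R : realType) (S : countType).

Let mass (k : S -> R) (i : nat) : R := oapp k 0 (@pickle_inv S i).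

Let mass_pickle k t : mass k (pickle t) = k t.
Proof. by rewrite /mass pickleK_inv. Qed.

Let cdf (k : S -> R) (n : nat) : R := \sum_(0 <= i < n) mass k i.

Let mass_ge0 D k n : is_distr D k -> 0 <= mass k n.
Proof. by case=> k0 _ _; rewrite /mass; case: pickle_inv => //=. Qed.

Let mass_series D k : is_distr D k ->
  (\sum_(0 <= i <oo) (mass k i)%:E = 1)%E.
Proof.
move=> kD; have [k0 _ <-] := kD.
rewrite nneseries_esumT; last by move=> n; rewrite lee_fin (mass_ge0 _ kD).
transitivity (\esum_(j in range (@pickle S)) (mass k j)%:E)%E.
  rewrite [RHS]esum_mkcond; apply: eq_esum => j _.
  case: ifPn => // jP; rewrite /mass.
  case E: (@pickle_inv S j) => [t|] //=; case/negP: jP.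
  by rewrite inE; exists t => //; have := @pickle_invK S j; rewrite /ocancel E.
rewrite (reindex_esum setT _ (@pickle S)).
  by apply: eq_esum => t _; rewrite mass_pickle.
split; [by move=> t _; exists t | | by []].
by move=> t u _ _; apply: (pcan_inj (@pickleK S)).
Qed.

Let cdf_le1 D k n : is_distr D k -> cdf k n <= 1.
Proof.
move=> kD; rewrite -lee_fin -(mass_series kD) /cdf -sumEFin.
by apply: nneseries_lim_ge => i _ _; rewrite lee_fin (mass_ge0 _ kD).
Qed.

Let cdfS k n : cdf k n.+1 = cdf k n + mass k n.
Proof. by rewrite /cdf big_nat_recr. Qed.

Let cdf_mono D k m n : is_distr D k -> (m <= n)%N -> cdf k m <= cdf k n.
Proof.
move=> kD /subnKC <-; elim: (n - m)%N => [|d IH]; first by rewrite addn0.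
by rewrite addnS cdfS (le_trans IH)// lerDl (mass_ge0 _ kD).
Qed.

Let cdf_gt D k u : is_distr D k -> u < 1 -> exists n, u < cdf k n.
Proof.
move=> kD u1; apply/not_existsP => h.
have: (\sum_(0 <= i <oo) (mass k i)%:E <= u%:E)%E.
  apply: lime_le; first by apply: is_cvg_nneseries => n _ _; rewrite lee_fin (mass_ge0 _ kD).
  by apply: nearW => n; rewrite sumEFin lee_fin leNgt; apply/negP/h.
by rewrite (mass_series kD) lee_fin leNgt u1.
Qed.

Let low k (t : S) := cdf k (pickle t).

Let low_ge0 D k t : is_distr D k -> 0 <= low k t.
Proof. by move=> kD; have := cdf_mono kD (leq0n (pickle t)); rewrite {1}/cdf big_geq. Qed.

Let high_le1 D k t : is_distr D k -> low k t + k t <= 1.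
Proof.
by move=> kD; have := cdf_le1 (pickle t).+1 kD; rewrite cdfS mass_pickle.
Qed.

Let in_slot k u t := low k t <= u < low k t + k t.

Let slot_ex D k u : is_distr D k -> 0 <= u < 1 -> exists t, in_slot k u t.
Proof.
move=> kD /andP[u0 u1]; have := cdf_gt kD u1 => /ex_minnP[[|n] hn hmin].
  by move: hn; rewrite /cdf big_geq// ltNge u0.
have un : cdf k n <= u.
  by rewrite leNgt; apply/negP => /hmin; rewrite ltnn.
have : mass k n != 0.
  by apply: contraTneq hn => m0; rewrite cdfS m0 addr0 -leNgt.
rewrite /mass; case E: (@pickle_inv S n) => [t|] /=; last by rewrite eqxx.
have tn : pickle t = n by have := @pickle_invK S n; rewrite /ocancel E.
by move=> _; exists t; rewrite /in_slot /low -mass_pickle -cdfS tn un hn.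
Qed.

Let slot_uniq D k u t t' : is_distr D k ->
  in_slot k u t -> in_slot k u t' -> t = t'.
Proof.
wlog tt' : t t' / (pickle t <= pickle t')%N.
  move=> h kD ut ut'; case/orP: (leq_total (pickle t) (pickle t')) => tt'.
    exact: h.
  by apply/esym/h.
move=> kD /andP[_ ut] /andP[ut' _]; apply: (pcan_inj (@pickleK S)).
apply/eqP; rewrite eqn_leq tt'/= leqNgt; apply/negP => lt.
move: ut; rewrite /low -mass_pickle -cdfS ltNge => /negP; apply.
exact: le_trans (cdf_mono kD lt) ut'.
Qed.

(* [K p] is the distribution of the next state after the finite path [p]. *)
Context (s0 : S) (K : seq S -> S -> R).
Hypothesis KP : forall p, is_distr xpredT (K p).

Fixpoint kernel_prob (p w : seq S) : R :=
  if w is t :: w' then K p t * kernel_prob (rcons p t) w' else 1.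

Let select p u : S := xget s0 [set t | in_slot (K p) u t].

Let selectP p u : 0 <= u < 1 -> in_slot (K p) u (select p u).
Proof. by move=> /(slot_ex (KP p))[t ut]; apply: (@xgetPex _ s0 [set t | in_slot (K p) u t]); exists t. Qed.

Let rescale p u := (u - low (K p) (select p u)) / K p (select p u).

Fixpoint sample p u n : S :=
  if n is n'.+1 then sample (rcons p (select p u)) (rescale p u) n'
  else select p u.

Fixpoint slot_low p w : R :=
  if w is t :: w' then low (K p) t + K p t * slot_low (rcons p t) w' else 0.

Let slot_bounds p w :
  [/\ 0 <= slot_low p w, 0 <= kernel_prob p w & slot_low p w + kernel_prob p w <= 1].
Proof.
elim: w p => [|t w IH] p /=; first by rewrite add0r lexx ler01.
have [l0 k0 lk1] := IH (rcons p t).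
have Kt : 0 <= K p t by case: (KP p).
split; rewrite ?addr_ge0 ?mulr_ge0//; first exact: low_ge0 (KP p).
rewrite -addrA -mulrDr (le_trans _ (high_le1 t (KP p)))// lerD2l.
by rewrite ler_piMr.
Qed.

Let rescaleP p u : 0 <= u < 1 ->
  0 < K p (select p u) /\ 0 <= rescale p u < 1.
Proof.
move=> /(selectP p)/andP[lu ul].
have K0 : 0 < K p (select p u) by rewrite -(ltrD2l (low (K p) (select p u))) addr0 (le_lt_trans lu).
split => //; rewrite /rescale divr_ge0 ?subr_ge0 ?(ltW K0)//=.
by rewrite ltr_pdivrMr// mul1r ltrBlDl.
Qed.

Let sampleP p u w : 0 <= u < 1 ->
  (mkseq (sample p u) (size w) == w) =
  (slot_low p w <= u < slot_low p w + kernel_prob p w).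
Proof.
elim: w p u => [|t w IH] p u u01 /=; first by rewrite add0r u01.
have [K0 r01] := rescaleP p u01.
rewrite /mkseq /= (iotaDl 1 0) -map_comp eqseq_cons.
rewrite (eq_map (_ : _ =1 sample (rcons p (select p u)) (rescale p u)))//.
have [<-|neq] /= := eqVneq (select p u) t.
  rewrite [LHS]IH// /rescale ler_pdivlMr// ltr_pdivrMr//.
  by rewrite lerBrDl ltrBlDl -addrA -mulrDr ![K _ _ * _]mulrC.
apply/esym/negbTE/negP => /andP[h1 h2]; move/eqP: neq; apply.
apply: (slot_uniq (KP p) (selectP p u01)).
have [l0 k0 lk1] := slot_bounds (rcons p t) w.
have Kt : 0 <= K p t by case: (KP p).
apply/andP; split; first by rewrite (le_trans _ h1)// lerDl mulr_ge0.
rewrite (lt_le_trans h2)// -addrA -mulrDr lerD2l.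
by rewrite ler_piMr.
Qed.

Let run_of (u : measurableTypeR R) : path_space s0 :=
  fun n => if (0 < n)%N && (0 <= u < 1) then sample [:: s0] u n.-1 else s0.

Let run_of_cylinder w : [set u | 0 <= u < 1] `&` (run_of @^-1` cylinder s0 (s0 :: w)) =
  [set` `[slot_low [:: s0] w, slot_low [:: s0] w + kernel_prob [:: s0] w[ ].
Proof.
have [l0 k0 lk1] := slot_bounds [:: s0] w.
apply/seteqP; split => u /=; rewrite in_itv/=.
  move=> [u01]; rewrite /cylinder/= /mkseq /= (iotaDl 1 0) -map_comp => -[].
  rewrite (eq_map (_ : _ =1 sample [:: s0] u)); last by move=> n /=; rewrite /run_of/= u01.
  by move/eqP; have := sampleP [:: s0] w u01; rewrite /mkseq => ->.
move=> /andP[h1 h2].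
have u01 : 0 <= u < 1 by rewrite (le_trans l0 h1) (lt_le_trans h2).
split => //; rewrite /cylinder/= /mkseq /= (iotaDl 1 0) -map_comp.
rewrite (eq_map (_ : _ =1 sample [:: s0] u)); last by move=> n /=; rewrite /run_of/= u01.
by congr cons; apply/eqP; have := sampleP [:: s0] w u01; rewrite /mkseq => ->; rewrite h1 h2.
Qed.

Let measurable_run_of : measurable_fun setT run_of.
Proof.
apply: (@measurability _ _ _ _ setT run_of (range (cylinder s0))) => // _ [_ [p _ <-] <-].
rewrite setTI; case: p => [|s w].
  by rewrite (_ : _ @^-1` _ = setT)//; apply/seteqP; split => // u _.
have [->|neq] := eqVneq s s0; last first.
  rewrite (_ : _ @^-1` _ = set0)//; apply/seteqP; split => // u [].
  by rewrite /run_of/= => e _; rewrite e eqxx in neq.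
have mI : measurable ([set u : R | 0 <= u < 1]).
  have -> : [set u : R | 0 <= u < 1] = [set` `[0, 1[ ].
    by apply/seteqP; split => u /=; rewrite in_itv.
  exact: measurable_itv.
rewrite -(setUIDK (run_of @^-1` _) [set u : R | 0 <= u < 1]); apply: measurableU.
  by rewrite setIC run_of_cylinder.
have [c0|c0] := pselect (cylinder s0 (s0 :: w) (fun=> s0)).
  rewrite (_ : _ `\` _ = ~` [set u : R | 0 <= u < 1]); first exact: measurableC.
  apply/seteqP; split => u /=; first by case.
  move=> /negP u01; split; last exact/negP.
  suff E : run_of u = fun=> s0 by move: c0; rewrite -E.
  by apply/funext => n; rewrite /run_of (negbTE u01) andbF.
rewrite (_ : _ `\` _ = set0)//; apply/seteqP; split => // u /= [cu /negP u01].
suff E : run_of u = fun=> s0 by apply: c0; rewrite -E.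
by apply/funext => n; rewrite /run_of (negbTE u01) andbF.
Qed.

Lemma kernel_measure_exists : exists P : probability (path_space s0) R,
  forall w, P (cylinder s0 (s0 :: w)) = (kernel_prob [:: s0] w)%:E.
Proof.
pose m0 := mrestr (@lebesgue_measure R) (measurable_itv `[0, 1[).
pose m : {measure set (path_space s0) -> \bar R} :=
  measure_function_pushforward__canonical__measure_function_Measure
    m0 measurable_run_of.
have mE w : m (cylinder s0 (s0 :: w)) = (kernel_prob [:: s0] w)%:E.
  rewrite /m /= /pushforward /m0 /mrestr setIC.
  have -> : [set` `[0, 1[ ] = [set u : R | 0 <= u < 1].
    by apply/seteqP; split => u /=; rewrite in_itv.
  rewrite run_of_cylinder lebesgue_measure_itv/= lte_fin ltrDl.
  have [_ k0 _] := slot_bounds [:: s0] w.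
  have [_|kle] := ltP; first by rewrite -EFinD addrAC subrr add0r.
  by apply/esym; congr EFin; apply/eqP; rewrite eq_le kle k0.
have mT : m setT = 1%E.
  rewrite /m /= /pushforward /m0 /mrestr preimage_setT setTI.
  by rewrite lebesgue_measure_itv/= lte_fin ltr01 oppr0 adde0.
suff normE (n : {measure set (path_space s0) -> \bar R}) P A :
    n setT = 1%E -> mnormalize n P A = n A.
  pose P0 : probability (path_space s0) R := dirac (point : path_space s0).
  by exists (mnormalize m P0) => w; rewrite -mE -(normE m P0 _ mT).
by move=> n1; rewrite /mnormalize n1 onee_eq0/= invr1 mule1.
Qed.

End IonescuTulcea.

Section RunProbability.
Context (R : realType) (S : countType) (M : mdp R S).

Let is_distrT D p : is_distr D p -> @is_distr R S xpredT p.
Proof. by case. Qed.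

Let is_distr_dirac (u : S) : @is_distr R S xpredT (fun t => (t == u)%:R).
Proof.
split=> //.
transitivity (\esum_(t in [set u]) (1%:E : \bar R))%E; last first.
  by rewrite esum_set1.
rewrite [RHS]esum_mkcond; apply: eq_esum => t _.
have [->|neq] := eqVneq t u; first by rewrite mem_set.
by rewrite memNset// => /= e; rewrite e eqxx in neq.
Qed.

Lemma next_probP (sigma : strategy M) h s : sorted (step M) (rcons h s) ->
  is_distr (step M s) (next_prob sigma h s).
Proof.
move=> hs; rewrite /next_prob; case: (boolP (controlled M s)) => cs; last exact: (probP cs).
by apply: (playP sigma); apply/andP.
Qed.

Let kernel (sigma : strategy M) (s0 : S) (p : seq S) : S -> R :=
  if p is s :: q then
    if sorted (step M) p then next_prob sigma (belast s q) (last s q)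
    else fun t => (t == s0)%:R
  else fun t => (t == s0)%:R.

Let kernelP sigma s0 p : is_distr xpredT (kernel sigma s0 p).
Proof.
rewrite /kernel; case: p => [|s q]; first exact: is_distr_dirac.
case: ifPn => sq; last exact: is_distr_dirac.
by apply: is_distrT; apply: next_probP; rewrite -lastI.
Qed.

Let kernelE sigma s0 h s : sorted (step M) (rcons h s) ->
  kernel sigma s0 (rcons h s) = next_prob sigma h s.
Proof.
rewrite /kernel; case E: (rcons h s) => [|x q]; first by case: h E.
move=> ->; move: E; rewrite lastI => /rcons_inj[<- <-]; by [].
Qed.

Let path_probE sigma s0 h s w : sorted (step M) (rcons h s) ->
  path_prob sigma h s w = kernel_prob (kernel sigma s0) (rcons h s) w.
Proof.
elim: w h s => [//|t w IH] h s hs /=; rewrite kernelE//.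
have [st|/negP nst] := boolP (step M s t); last first.
  have [_ n0 _] := next_probP sigma hs.
  by rewrite n0 ?mul0r//; exact/negP.
rewrite IH//; move: hs; case: h => [|x h] /=; first by rewrite st.
by rewrite !rcons_path last_rcons st => ->.
Qed.

Lemma run_prob_exists (sigma : strategy M) (s : S) :
  exists P : probability (path_space s) R,
    forall w, P (cylinder s (s :: w)) = (path_prob sigma [::] s w)%:E.
Proof.
have [P PE] := kernel_measure_exists s (kernelP sigma s).
by exists P => w; rewrite PE (@path_probE sigma s).
Qed.

(* The measure induced by a strategy and a start state [s]: the unique one giving
   each finite path from [s] the product of its transition probabilities. *)
Definition run_prob (sigma : strategy M) (s : S) : probability (path_space s) R :=
  sval (cid (run_prob_exists sigma s)).

Lemma run_probE sigma s w :
  run_prob sigma s (cylinder s (s :: w)) = (path_prob sigma [::] s w)%:E.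
Proof. exact: (svalP (cid (run_prob_exists sigma s))). Qed.

End RunProbability.

Lemma measurable_cylinder (S : countType) (s : S) p :
  measurable (cylinder s p : set (path_space s)).
Proof. by apply: sub_sigma_algebra; exists p. Qed.

Lemma cylinder_nil (S : countType) (s : S) : cylinder s [::] = setT.
Proof. by apply/seteqP; split. Qed.

Lemma cylinder_setI (S : countType) (s : S) p q : (size p <= size q)%N ->
  cylinder s p `&` cylinder s q =
  if take (size p) q == p then cylinder s q else set0.
Proof.
move=> pq; have tk (r : nat -> S) : mkseq r (size q) = q ->
    mkseq r (size p) = take (size p) q.
  by move=> rq; rewrite -[in RHS]rq /mkseq -map_take take_iota (minn_idPl pq).
apply/seteqP; split => r.
  by move=> [rp rq]; case: ifPn => // /eqP[]; rewrite -(tk r rq).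
case: ifPn => // /eqP pE rq; split => //.
by rewrite /cylinder/= (tk r rq).
Qed.

Section RunProbabilityTheory.
Context (R : realType) (S : countType) (M : mdp R S).

Let cylinder_other (s x : S) (w : seq S) (P : probability (path_space s) R) :
  P (cylinder s [:: s]) = 1%E -> x != s -> P (cylinder s (x :: w)) = 0%E.
Proof.
move=> P1 xs; apply/eqP; rewrite eq_le measure_ge0 andbT.
have <- : P (~` cylinder s [:: s]) = 0%E.
  rewrite probability_setC; first by rewrite P1 subee.
  exact: measurable_cylinder.
apply: le_measure; rewrite ?inE.
- exact: measurable_cylinder.
- by apply: measurableC; exact: measurable_cylinder.
- by move=> r [rx _] [rs]; rewrite -rx rs eqxx in xs.
Qed.

Lemma run_prob_unique (sigma : strategy M) (s : S)
    (P : probability (path_space s) R) :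
  (forall w, P (cylinder s (s :: w)) = (path_prob sigma [::] s w)%:E) ->
  forall A, measurable A -> P A = run_prob sigma s A.
Proof.
move=> PE; pose G : set (set (path_space s)) := range (cylinder s) `|` [set set0].
apply: (measure_unique G (fun=> setT)).
- apply/seteqP; split.
    apply: smallest_sub; first exact: smallest_sigma_algebra.
    by move=> _ [p _ <-]; apply: sub_sigma_algebra; left; exists p.
  apply: smallest_sub; first exact: sigma_algebra_measurable.
  move=> A [[p _ <-]|->]; first exact: measurable_cylinder.
  exact: (@measurable0 _ (path_space s)).
- have G0 : G set0 by right.
  have GI p q : G (cylinder s p `&` cylinder s q).
    wlog pq : p q / (size p <= size q)%N.
      move=> h; case/orP: (leq_total (size p) (size q)) => pq; first exact: h.
      by rewrite setIC; apply: h.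
    by rewrite cylinder_setI//; case: ifP => _; [left; exists q|right].
  move=> A B [[p _ <-]|->] [[q _ <-]|->]; rewrite ?setI0 ?set0I//; exact: GI.
- by move=> _; left; exists [::] => //; rewrite cylinder_nil.
- by apply/seteqP; split => // x _; exists 0%N.
- have PT (Q : probability (path_space s) R) : Q (cylinder s [::]) = 1%E.
    by rewrite cylinder_nil; exact: probability_setT.
  move=> A [[p _ <-]|->]; last by rewrite !measure0.
  case: p => [|x w]; first exact: etrans (PT P) (esym (PT _)).
  have [->|xs] := eqVneq x s.
    exact: etrans (PE w) (esym (run_probE sigma s w)).
  have P0 (Q : probability (path_space s) R) :
      Q (cylinder s [:: s]) = 1%E -> Q (cylinder s (x :: w)) = 0%E.
    by move=> Q1; exact: cylinder_other.
  by apply: etrans (P0 P _) (esym (P0 _ _)); rewrite ?PE ?run_probE.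
- move=> _; apply: (@le_lt_trans _ _ 1%E); last exact: ltry.
  exact: (probability_le1 P measurableT).
Qed.

Lemma run_prob_runs (sigma : strategy M) (s : S) :
  {ae run_prob sigma s, forall r, r 0%N = s /\ is_run M r}.
Proof.
pose bad (p : seq S) := ~~ (if p is x :: w then (x == s) && path (step M) x w else true).
have bad0 p : bad p -> run_prob sigma s (cylinder s p) = 0%E.
  case: p => // x w; rewrite /bad; have [->|xs _] := eqVneq x s; last first.
    by rewrite cylinder_other// run_probE.
  move=> /= nw; rewrite run_probE; congr EFin.
  suff H h y v : sorted (step M) (rcons h y) -> ~~ path (step M) y v ->
      path_prob sigma h y v = 0 by exact: H.
  elim: v h y => //= t v IH h y hy.
  have [st|nst _] := boolP (step M y t).
    move=> nv; rewrite IH ?mulr0//; move: hy; case: h => [|z h] /=; first by rewrite st.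
    by rewrite !rcons_path last_rcons st => ->.
  by have [_ n0 _] := next_probP sigma hy; rewrite n0 ?mul0r.
pose N n : set (path_space s) :=
  if unpickle n is Some p then if bad p then cylinder s p else set0 else set0.
have: (run_prob sigma s).-negligible (\bigcup_n N n).
  apply: negligible_bigcup => n; rewrite /N.
  case: unpickle => [p|]; last exact: negligible_set0.
  case: ifPn => [bp|_]; last exact: negligible_set0.
  apply/negligibleP; [exact: measurable_cylinder | exact: bad0].
apply: negligibleS => r /= nr; apply: contrapT => nN; apply: nr.
have good n : ~~ bad (mkseq r n).
  apply/negP => b; apply: nN; exists (pickle (mkseq r n)) => //.
  by rewrite /N pickleK b /cylinder/= size_mkseq.
have r0 : r 0%N = s by have := good 1%N; rewrite /bad negbK /= andbT => /eqP.
have goodP x w : ~~ bad (x :: w) -> path (step M) x w.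
  by rewrite /bad negbK => /andP[].
split => // n; have := good n.+2.
case E : (mkseq r n.+2) => [|x w]; first by have := size_mkseq r n.+2; rewrite E.
have sw : size w = n.+1 by have := size_mkseq r n.+2; rewrite E => -[].
move=> /goodP /(pathP s)/(_ n); rewrite sw ltnSn => /(_ isT).
have -> : nth s (x :: w) n = r n by rewrite -E nth_mkseq.
by have -> : nth s w n = r n.+1 by rewrite -[nth s w n]/(nth s (x :: w) n.+1) -E nth_mkseq.
Qed.

End RunProbabilityTheory.

Section Objectives.
Context (R : realType) (S : countType) (M : mdp R S).

Definition FG (A : set (S * S)) : set (nat -> S) :=
  [set r | is_run M r /\
           exists N, forall n, (N <= n)%N -> A (r n, r n.+1)].

Definition value (s : S) (phi : set (nat -> S)) : \bar R :=
  ereal_sup [set run_prob sigma s phi | sigma in [set: strategy M]].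

Definition eps_optimal (eps : R) (s : S) (phi : set (nat -> S))
    (sigma : strategy M) :=
  (value s phi - eps%:E <= run_prob sigma s phi)%E.

Definition infinitely_often (t : S) : set (nat -> S) :=
  [set r | forall N, exists2 n, (N <= n)%N & r n = t].

Definition universally_transient :=
  forall (s : S) (sigma : strategy M),
    {ae run_prob sigma s, forall r, forall t, ~ infinitely_often t r}.

End Objectives.

(* Main.v *)
(* Call an index of a state "small" below N, the index being its number in an
   enumeration of S under universal transience, and the current time in general.
   Fix a near-optimal strategy. By continuity of measure there are N_i such that,
   up to probability 2^-(i+1) e, every transition of a winning run that leaves a
   state of index at least N_i is in A_i. The conjunction of these
   conditions over all i is a safety objective; it implies phi almost surely,
   since almost every run leaves the small states forever.

   For a safety objective, the conditional probabilities of staying safe under the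
   fixed strategy have a supremum v, over all histories with the same state (and
   time), which is subharmonic. Choosing at each controlled state s a successor
   that loses at most loss(s) of v costs at most the expected total loss. This is
   bounded by a superharmonic psi with psi >= loss + psi(successor): in general
   psi = 2^-time e; under universal transience psi is a weighted sum over x of the
   maximal probabilities of reaching x, which gain at x the positive probability
   of never returning there. *)
Require Import Defs.
From mathcomp Require Import all_boot all_order all_algebra.
From mathcomp Require Import all_classical all_reals all_analysis.
From mathcomp Require Import ring lra.

Set Implicit Arguments.
Unset Strict Implicit.
Unset Printing Implicit Defensive.
Import Order.TTheory GRing.Theory Num.Theory.

Local Open Scope classical_set_scope.
Local Open Scope ring_scope.

(** * Weighted sums of bounded functions over the states *)

Section Mean.
Context (R : realType) (S : countType).
Implicit Types (p f g : S -> R).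

Lemma esum_pickle (g : S -> \bar R) : (forall t, 0 <= g t)%E ->
  (\esum_(t in [set: S]) g t =
   \sum_(0 <= i <oo) oapp g 0 (@pickle_inv S i))%E.
Proof.
move=> g0; rewrite nneseries_esumT; last by move=> n; case: pickle_inv.
transitivity (\esum_(j in range (@pickle S)) (oapp g 0 (@pickle_inv S j)))%E.
  rewrite (reindex_esum setT _ (@pickle S)).
    by apply: eq_esum => t _; rewrite pickleK_inv.
  split; [by move=> t _; exists t | | by []].
  by move=> t u _ _; apply: (pcan_inj (@pickleK S)).
rewrite esum_mkcond; apply: eq_esum => j _.
case: ifPn => // jP; case E: (@pickle_inv S j) => [t|] //=; case/negP: jP.
by rewrite inE; exists t => //; have := @pickle_invK S j; rewrite /ocancel E.
Qed.

Lemma esum_dirac (u : S) (x : \bar R) : (0 <= x)%E ->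
  (\esum_(t in [set: S]) (if t == u then x else 0) = x)%E.
Proof.
move=> x0; transitivity (\esum_(t in [set u]) x)%E; last by rewrite esum_set1.
rewrite [RHS]esum_mkcond; apply: eq_esum => t _.
have [->|neq] := eqVneq t u; first by rewrite mem_set.
by rewrite memNset// => /= e; rewrite e eqxx in neq.
Qed.

(** Only finite total mass is required, so that transition distributions and summable weights on
    target states are both covered. *)
Definition weight p := (forall t, 0 <= p t) /\ (\esum_(t in [set: S]) (p t)%:E < +oo)%E.

Definition nonneg_bounded f := exists C, forall t, 0 <= f t <= C.

(** Real-valued, so that linear arithmetic applies; [fine] loses nothing for a [weight] and a
    [nonneg_bounded] function, whose sum is finite. *)
Definition mean p f : R := fine (\esum_(t in [set: S]) (p t * f t)%:E)%E.

Lemma is_distr_weight D p : is_distr D p -> weight p.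
Proof. by case=> p0 _ p1; split => //; rewrite p1 ltry. Qed.

Lemma esumZl (c : R) (g : S -> \bar R) : 0 <= c -> (forall t, 0 <= g t)%E ->
  (\esum_(t in [set: S]) (c%:E * g t) = c%:E * \esum_(t in [set: S]) g t)%E.
Proof.
move=> c0 g0; rewrite !esum_pickle//; last by move=> t; rewrite mule_ge0.
rewrite -nneseriesZl; last by move=> i _; case: pickle_inv => //=.
by apply: eq_eseriesr => i _; case: pickle_inv => //=; rewrite mule0.
Qed.

Lemma meanE p f : weight p -> nonneg_bounded f ->
  (mean p f)%:E = (\esum_(t in [set: S]) (p t * f t)%:E)%E.
Proof.
move=> [p0 ps] [C fC]; rewrite /mean fineK// ge0_fin_numE; last first.
  by apply: esum_ge0 => t _; rewrite lee_fin mulr_ge0//; have /andP[] := fC t.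
(* A state is needed to see that [C] is nonnegative, so the bound uses [|C|], which also serves for
   empty [S]. *)
have C0 (t : S) : 0 <= C by have /andP[a b] := fC t; exact: le_trans a b.
have H : (\esum_(t in [set: S]) (p t * f t)%:E <= `|C|%:E * \esum_(t in [set: S]) (p t)%:E)%E.
  rewrite -esumZl//; apply: le_esum => t _; rewrite -EFinM lee_fin mulrC ler_wpM2r//.
  by have /andP[a b] := fC t; rewrite ger0_norm// (C0 t).
apply: (le_lt_trans H); apply: lte_mul_pinfty => //.
Qed.

Lemma mean_ge0 p f : weight p -> nonneg_bounded f -> 0 <= mean p f.
Proof.
move=> wp bf; rewrite -lee_fin meanE//; have [p0 _] := wp; have [C fC] := bf.
by apply: esum_ge0 => t _; rewrite lee_fin mulr_ge0//; have /andP[] := fC t.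
Qed.

Lemma eq_mean p f g : (forall t, p t != 0 -> f t = g t) -> mean p f = mean p g.
Proof.
move=> fg; rewrite /mean; congr fine; apply: eq_esum => t _.
by have [->|p0] := eqVneq (p t) 0; rewrite ?mul0r// fg.
Qed.

Lemma mean_le p f g : weight p -> nonneg_bounded f -> nonneg_bounded g ->
  (forall t, p t != 0 -> f t <= g t) -> mean p f <= mean p g.
Proof.
move=> wp bf bg fg; rewrite -lee_fin !meanE//; apply: le_esum => t _.
have [->|pt0] := eqVneq (p t) 0; first by rewrite !mul0r.
by rewrite lee_fin ler_wpM2l ?fg//; case: wp.
Qed.

Lemma nonneg_boundedD f g : nonneg_bounded f -> nonneg_bounded g ->
  nonneg_bounded (fun t => f t + g t).
Proof.
move=> [C fC] [D gD]; exists (C + D) => t.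
by have := fC t; have := gD t; lra.
Qed.

Lemma nonneg_bounded_cst (c : R) : 0 <= c -> nonneg_bounded (fun=> c).
Proof. by move=> c0; exists c => t; rewrite c0 lexx. Qed.

Lemma nonneg_bounded_if (b : pred S) f g : nonneg_bounded f -> nonneg_bounded g ->
  nonneg_bounded (fun t => if b t then f t else g t).
Proof.
move=> [C fC] [D gD]; exists (Num.max C D) => t; rewrite le_max.
by case: ifP => _; [have /andP[-> ->] := fC t|have /andP[-> ->] := gD t; rewrite orbT].
Qed.

Lemma meanD p f g : weight p -> nonneg_bounded f -> nonneg_bounded g ->
  mean p (fun t => f t + g t) = mean p f + mean p g.
Proof.
move=> wp bf bg; apply: EFin_inj; rewrite EFinD !meanE//; last exact: nonneg_boundedD.
case: wp bf bg => p0 _ [C fC] [D gD].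
rewrite -esumD; last 2 first.
- by move=> t _; rewrite lee_fin mulr_ge0//; have /andP[] := fC t.
- by move=> t _; rewrite lee_fin mulr_ge0//; have /andP[] := gD t.
by apply: eq_esum => t _; rewrite mulrDr EFinD.
Qed.

Lemma mean_cst D p c : is_distr D p -> 0 <= c -> mean p (fun=> c) = c.
Proof.
move=> pD c0; apply: EFin_inj; rewrite meanE; [|exact: is_distr_weight pD|exact: nonneg_bounded_cst].
case: pD => p0 _ p1; rewrite -[RHS]mule1 -p1 -esumZl//.
by apply: eq_esum => t _; rewrite -EFinM mulrC.
Qed.

Lemma mean_le_cst D p f c : is_distr D p -> nonneg_bounded f -> 0 <= c ->
  (forall t, D t -> f t <= c) -> mean p f <= c.
Proof.
move=> pD bf c0 fc; rewrite -[leRHS](mean_cst pD c0).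
apply: mean_le => //; [exact: is_distr_weight pD|exact: nonneg_bounded_cst|].
move=> t pt0; apply: fc; apply: contraNT pt0 => nDt.
by case: pD => _ /(_ _ nDt) ->.
Qed.

Lemma is_distr_dirac (D : pred S) (u : S) : D u -> is_distr D (fun t => (t == u)%:R : R).
Proof.
move=> Du; split => [t|t|]; first by [].
  by have [->|//] := eqVneq t u; rewrite Du.
rewrite -[RHS](@esum_dirac u)//; apply: eq_esum => t _; by case: eqP.
Qed.

Lemma mean_dirac (u : S) f : nonneg_bounded f ->
  mean (fun t => (t == u)%:R) f = f u.
Proof.
move=> [C fC]; rewrite /mean -[RHS]/(fine (f u)%:E); congr fine.
rewrite -[RHS](@esum_dirac u); last by rewrite lee_fin; have /andP[] := fC u.
by apply: eq_esum => t _; case: eqP => [->|_]; rewrite ?mul1r ?mul0r.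
Qed.

(** Tonelli: both iterated sums equal a nonnegative sum over pairs, and swapping the coordinates is
    a bijection. *)
Lemma mean_exchange (p w : S -> R) (g : S -> S -> R) : weight p -> weight w ->
  (forall t y, 0 <= g t y <= 1) ->
  mean p (fun t => mean w (g t)) = mean w (fun y => mean p (g^~ y)).
Proof.
move=> wp ww g01; have [p0 _] := wp; have [w0 _] := ww.
have E (q u : S -> R) (f : S -> S -> R) : weight q -> weight u ->
    (forall t y, 0 <= f t y <= 1) -> mean q (fun t => mean u (f t)) =
    fine (\esum_(k in [set: S * S]) (q k.1 * (u k.2 * f k.1 k.2))%:E)%E.
  move=> wq wu f01; rewrite /mean; congr fine; have [q0 _] := wq; have [u0 _] := wu.
  have t0 k l : (0 <= (q k * (u l * f k l))%:E)%E.
    by rewrite lee_fin !mulr_ge0//; have /andP[] := f01 k l.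
  rewrite -[[set: S * S]]setXTT.
  have -> : [set: S] `*` [set: S] = [set: S] `*`` (fun=> [set: S]) by [].
  rewrite -(@esum_esum _ _ _ [set: S] (fun=> [set: S]) (fun k l => (q k * (u l * f k l))%:E))//.
  apply: eq_esum => t _; rewrite EFinM meanE//; last by exists 1.
  rewrite -esumZl//; last first.
    by move=> y; rewrite lee_fin mulr_ge0//; have /andP[] := f01 t y.
rewrite E// (E w p (fun y t => g t y))//; congr fine.
rewrite (reindex_esum [set: S * S] [set: S * S] (fun k => (k.2, k.1))).
  by apply: eq_esum => -[t y] _ /=; congr EFin; ring.
split=> //; first by move=> [a b] [c d] _ _ /= [-> ->].
by move=> [a b] _; exists (b, a).
Qed.

Lemma mean_at (w : S -> R) s a : weight w -> 0 <= a ->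
  mean w (fun y => if y == s then a else 0) = w s * a.
Proof.
move=> [w0 _] a0; rewrite /mean -[RHS]/(fine (w s * a)%:E); congr fine.
rewrite -(@esum_dirac s (w s * a)%:E) ?lee_fin ?mulr_ge0//.
by apply: eq_esum => y _; case: eqP => [->|_]; rewrite ?mulr0.
Qed.

Lemma small_weight (e : R) : 0 < e -> exists w : S -> R,
  [/\ weight w, forall s, 0 < w s & mean w (fun=> 1) <= e].
Proof.
(* Distinct states have distinct codes, so the total is at most the sum of all [e / 2^(i+1)], which
   is [e]. *)
move=> e0; pose w (s : S) : R := e / (2 ^ (pickle s).+1)%:R.
have w0 s : 0 < w s by rewrite divr_gt0// ltr0n expn_gt0.
have le : (\esum_(s in [set: S]) (w s)%:E <= e%:E)%E.
  rewrite esum_pickle; last by move=> s; rewrite lee_fin ltW.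
  apply: le_trans (epsilon_trick0 xpredT (ltW e0)).
  apply: lee_nneseries => [i _|i _].
    by case: pickle_inv => //= s; rewrite lee_fin ltW.
  case Ei: (@pickle_inv S i) => [s|] /=; last first.
    by rewrite lee_fin divr_ge0// ltW.
  by have := @pickle_invK S i; rewrite /ocancel Ei /= => <-.
have ww : weight w by split => [s|]; [exact: ltW|exact: le_lt_trans le (ltry _)].
exists w; split => //; rewrite -lee_fin meanE//; last exact: nonneg_bounded_cst.
by under eq_esum do rewrite mulr1.
Qed.

End Mean.

(** * Safety events and their measurability *)

Lemma mkseq_rcons (T : Type) (r : nat -> T) n : mkseq r n.+1 = rcons (mkseq r n) (r n).
Proof. by rewrite /mkseq -addn1 iotaD map_cat cats1 add0n. Qed.

Section Events.
Context (S : countType) (s0 : S).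

(** [B] judges each transition with the past in view, its first argument being the path strictly
    before the current state. Conditions before time [n] are dropped, so that after a path [h] the
    event from [size h] on concerns the future only. *)
Definition safe (B : seq S -> S -> pred S) (n : nat) : set (path_space s0) :=
  [set r | forall i, (n <= i)%N -> B (mkseq r i) (r i) (r i.+1)].

(** Finite paths are countable, so an event decided by a prefix is a countable union of
    cylinders. *)
Lemma measurable_prefix n (D : set (seq S)) :
  measurable ([set r | D (mkseq r n)] : set (path_space s0)).
Proof.
rewrite (_ : [set r | _] = \bigcup_k
    (if unpickle k is Some p then
       if (size p == n) && `[< D p >] then cylinder s0 p else set0 else set0)).
  apply: bigcupT_measurable => k /=.
  case: ifP => _; [exact: measurable_cylinder|exact: measurable0].
apply/seteqP; split => r.
  move=> Dr; exists (pickle (mkseq r n)); first by [].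
  rewrite pickleK size_mkseq eqxx asboolT//.
  by rewrite /cylinder/= size_mkseq.
move=> [k _]; case: unpickle => [p|] //; case: ifP => // /andP[/eqP sp /asboolP Dp].
by rewrite /cylinder/= sp => ->.
Qed.

Lemma measurable_step n (Q : S -> S -> Prop) :
  measurable ([set r | Q (r n) (r n.+1)] : set (path_space s0)).
Proof.
rewrite (_ : [set r | _] =
    [set r | [set p | Q (nth s0 p n) (nth s0 p n.+1)] (mkseq r n.+2)]).
  exact: measurable_prefix.
by apply/funext => r; rewrite /mkset !nth_mkseq.
Qed.

Lemma measurable_safe B n : measurable (safe B n).
Proof.
rewrite (_ : safe B n = \bigcap_(i in [set i | (n <= i)%N])
    [set r | B (mkseq r i) (r i) (r i.+1)]); last first.
  by apply/seteqP; split => r H i; exact: H.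
apply: bigcap_measurable; first by exists n => /=.
move=> i _; rewrite (_ : [set r | _] =
    [set r | [set p | B (take i p) (nth s0 p i) (nth s0 p i.+1)] (mkseq r i.+2)]).
  exact: measurable_prefix.
apply/funext => r; rewrite /mkset !nth_mkseq//.
by rewrite /mkseq -map_take take_iota (minn_idPl _)// !leqW.
Qed.

Lemma cylinder_rconsE h s (r : path_space s0) :
  cylinder s0 (rcons h s) r <-> mkseq r (size h) = h /\ r (size h) = s.
Proof.
rewrite /cylinder/= size_rcons mkseq_rcons; split.
  by move=> /rcons_inj[].
by move=> [-> ->].
Qed.

(** The cylinder fixes the transition at time [size h], so the condition there either holds
    throughout or excludes every run. *)
Lemma cylinder_safe_step B h s t :
  cylinder s0 (rcons (rcons h s) t) `&` safe B (size h) =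
  if B h s t then cylinder s0 (rcons (rcons h s) t) `&` safe B (size h).+1 else set0.
Proof.
apply/seteqP; split => r.
  move=> [/[dup] c /cylinder_rconsE[]]; rewrite size_rcons => /[!mkseq_rcons] /rcons_inj[rh rs] rt sf.
  have := sf _ (leqnn _); rewrite rh rs rt => ->; split => // i hi; apply: sf.
  exact: ltnW.
case: ifP => // Bt [/[dup] c /cylinder_rconsE[]].
rewrite size_rcons => /[!mkseq_rcons] /rcons_inj[rh rs] rt sf; split => // i.
by rewrite leq_eqVlt => /orP[/eqP <-|/sf//]; rewrite rh rs rt.
Qed.

End Events.
Arguments safe {S} s0 B n.

(** * Probabilities of finite paths and of staying safe *)

Section RunMeasure.
Context (R : realType) (S : countType) (M : mdp R S) (sigma : strategy M) (s0 : S).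
Implicit Types (A : set (path_space s0)) (B : seq S -> S -> pred S).

Definition pr A : R := fine (run_prob sigma s0 A).

Lemma prE A : measurable A -> (pr A)%:E = run_prob sigma s0 A.
Proof. by move=> mA; rewrite /pr fineK// fin_num_measure. Qed.

Lemma pr_ge0 A : 0 <= pr A.
Proof. by rewrite /pr fine_ge0. Qed.

Lemma pr_le A A' : measurable A -> measurable A' -> A `<=` A' -> pr A <= pr A'.
Proof. by move=> mA mA' AA'; rewrite -lee_fin !prE// le_measure// inE. Qed.

Lemma pr0 : pr set0 = 0.
Proof. by rewrite /pr measure0. Qed.

Definition mass p : R := pr (cylinder s0 p).

Lemma mass_ge0 p : 0 <= mass p. Proof. exact: pr_ge0. Qed.

Lemma mass_start : mass [:: s0] = 1.
Proof. by rewrite /mass /pr run_probE. Qed.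

(** The measure is concentrated on runs from [s0], so the cylinder of any other sequence is null. *)
Lemma mass_sorted p x : mass (x :: p) != 0 -> x = s0 /\ path (step M) x p.
Proof.
move=> m0; apply: contrapT => nxp; move/negP: m0; apply; apply/eqP.
apply: EFin_inj; rewrite prE; last exact: measurable_cylinder.
apply/negligibleP; first exact: measurable_cylinder.
apply: negligibleS (run_prob_runs sigma s0) => r /= rxp [r0 rr]; apply: nxp.
have E k : (k <= size p)%N -> nth s0 (x :: p) k = r k.
  by move=> kp; rewrite -[x :: p]rxp nth_mkseq.
split; first by have := E 0%N isT; rewrite /= r0.
apply/(pathP s0) => i ip; rewrite -[nth s0 p i]/(nth s0 (x :: p) i.+1) !E//.
exact: ltnW.
Qed.

(** [path_prob] unfolds from the front, while [mass_rcons] extends a path at its end. *)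
Lemma path_prob_rcons h s w t : path_prob sigma h s (rcons w t) =
  path_prob sigma h s w * next_prob sigma (h ++ belast s w) (last s w) t.
Proof.
elim: w h s => [|u w IH] h s /=; first by rewrite cats0 mulr1 mul1r.
by rewrite IH mulrA cat_rcons.
Qed.

Lemma mass_rcons h s t :
  mass (rcons (rcons h s) t) = mass (rcons h s) * next_prob sigma h s t.
Proof.
have [x [w E]] : exists x w, rcons h s = x :: w.
  by case: h => [|y h]; [exists s, [::]|exists y, (rcons h s)].
rewrite E rcons_cons; have [xs|/eqP xs] := pselect (x = s0); last first.
  have m0 q : mass (x :: q) = 0.
    by apply/eqP; apply: contraT => /mass_sorted[] /eqP; rewrite (negbTE xs).
  by rewrite !m0 mul0r.
move: E; rewrite lastI => /rcons_inj[-> ->].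
by rewrite -lastI xs /mass /pr !run_probE path_prob_rcons.
Qed.

Lemma mass_next_distr h s : mass (rcons h s) != 0 ->
  is_distr (step M s) (next_prob sigma h s).
Proof.
move=> m0; apply: next_probP; move: m0; case: h => [|x h]//=.
by move=> /mass_sorted[].
Qed.

(** A joint probability rather than a conditional one, so that paths of probability zero need no
    exception. *)
Definition safe_mass B h s : R :=
  pr (cylinder s0 (rcons h s) `&` safe s0 B (size h)).

Lemma measurable_cylinder_safe B p n :
  measurable (cylinder s0 p `&` safe s0 B n : set (path_space s0)).
Proof. by apply: measurableI; [exact: measurable_cylinder|exact: measurable_safe]. Qed.

Lemma safe_mass_ge0 B h s : 0 <= safe_mass B h s. Proof. exact: pr_ge0. Qed.

Lemma safe_mass_le B h s : safe_mass B h s <= mass (rcons h s).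
Proof.
apply: pr_le; [exact: measurable_cylinder_safe|exact: measurable_cylinder|].
exact: subIsetl.
Qed.

(** Countable additivity over the next state; a transition rejected by [B] contributes nothing. *)
Lemma safe_mass_step B h s : (safe_mass B h s)%:E =
  (\esum_(t in [set: S]) (if B h s t then safe_mass B (rcons h s) t else 0)%:E)%E.
Proof.
pose F t := cylinder s0 (rcons (rcons h s) t) `&` safe s0 B (size h).
have mF t : measurable (F t : set (path_space s0)) by exact: measurable_cylinder_safe.
pose G i := oapp F set0 (@pickle_inv S i).
have FE t : (if B h s t then safe_mass B (rcons h s) t else 0) = pr (F t).
  rewrite /F cylinder_safe_step /safe_mass size_rcons; case: ifP => // _.
  by rewrite pr0.
rewrite prE; last exact: measurable_cylinder_safe.
transitivity (run_prob sigma s0 (\bigcup_i G i)).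
  congr (run_prob _ _ _); apply/seteqP; split => r.
    move=> [rc rs]; exists (pickle (r (size h).+1)) => //.
    rewrite /G pickleK_inv /= /F; split => //; apply/cylinder_rconsE.
    rewrite size_rcons mkseq_rcons; split => //.
    by move/cylinder_rconsE: rc => [-> ->].
  move=> [i _]; rewrite /G; case: pickle_inv => //= t [/cylinder_rconsE[]].
  rewrite size_rcons mkseq_rcons => /rcons_inj[rh rs] _ sf; split => //.
  exact/cylinder_rconsE.
rewrite measure_bigcup; last 2 first.
- by move=> i _; rewrite /G; case: pickle_inv => //=; exact: measurable0.
- move=> i j _ _; rewrite /G.
  case Ei: (@pickle_inv S i) => [t|] /=; last by rewrite set0I => -[].
  case Ej: (@pickle_inv S j) => [u|] /=; last by rewrite setI0 => -[].
  move=> [r [[/cylinder_rconsE[_ rt] _] [/cylinder_rconsE[_ ru] _]]].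
  have := @pickle_invK S i; have := @pickle_invK S j.
  by rewrite /ocancel Ei Ej /= -rt -ru => <- <-.
rewrite esum_pickle; last by move=> t; rewrite FE lee_fin pr_ge0.
rewrite eseries_mkcond; apply: eq_eseriesr => i _; rewrite in_setT /G.
case: pickle_inv => [t|] /=; last by rewrite measure0.
by rewrite FE prE.
Qed.

End RunMeasure.

(** * Bounding safety probabilities by one-step inequalities *)

Section Potential.
Context (R : realType) (S : countType) (M : mdp R S) (sigma : strategy M) (s0 : S).
Implicit Types (B : seq S -> S -> pred S).

Local Notation mass := (mass sigma s0).
Local Notation safe_mass := (safe_mass sigma s0).
Local Notation next := (next_prob sigma).

Lemma mass_mean h s f : mass (rcons h s) != 0 -> nonneg_bounded f ->
  (mass (rcons h s) * mean (next h s) f)%:E =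
  (\esum_(t in [set: S]) (mass (rcons (rcons h s) t) * f t)%:E)%E.
Proof.
move=> m0 bf; have wn := is_distr_weight (mass_next_distr m0).
rewrite EFinM meanE// -esumZl ?mass_ge0//; last first.
  move=> t; have [C fC] := bf; have [n0 _] := wn.
  by rewrite lee_fin mulr_ge0//; have /andP[] := fC t.
by apply: eq_esum => t _; rewrite -EFinM mass_rcons mulrA.
Qed.

Lemma safe_mass_upper B h s f : nonneg_bounded f ->
  (forall t, safe_mass B (rcons h s) t <= mass (rcons (rcons h s) t) * f t) ->
  safe_mass B h s <=
    mass (rcons h s) * mean (next h s) (fun t => if B h s t then f t else 0).
Proof.
move=> bf sf; have [m0|m0] := eqVneq (mass (rcons h s)) 0.
  by rewrite m0 mul0r -m0 safe_mass_le.
rewrite -lee_fin mass_mean//; last first.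
  by apply: nonneg_bounded_if => //; exact: nonneg_bounded_cst.
rewrite safe_mass_step; apply: le_esum => t _; rewrite lee_fin.
by case: ifP => _; rewrite ?mulr0.
Qed.

(** [g] is an error allowance: [f] may exceed the conditional safety probability of a successor by
    [g], and these errors enter the bound through their mean. *)
Lemma safe_mass_lower B h s f g : nonneg_bounded f -> nonneg_bounded g ->
  (forall t, B h s t -> mass (rcons (rcons h s) t) * f t <=
     safe_mass B (rcons h s) t + mass (rcons (rcons h s) t) * g t) ->
  mass (rcons h s) * mean (next h s) (fun t => if B h s t then f t else 0) <=
    safe_mass B h s + mass (rcons h s) * mean (next h s) g.
Proof.
move=> bf bg sf; have [m0|m0] := eqVneq (mass (rcons h s)) 0.
  by rewrite m0 !mul0r addr0 safe_mass_ge0.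
have g0 t : 0 <= g t by have [C gC] := bg; have /andP[] := gC t.
rewrite -lee_fin EFinD !mass_mean//; last first.
  by apply: nonneg_bounded_if => //; exact: nonneg_bounded_cst.
rewrite safe_mass_step -esumD; last 2 first.
- by move=> t _; rewrite lee_fin; case: ifP => // _; exact: safe_mass_ge0.
- by move=> t _; rewrite lee_fin mulr_ge0// mass_ge0.
apply: le_esum => t _; rewrite -EFinD lee_fin; case: ifP => [/sf//|_].
by rewrite mulr0 add0r mulr_ge0// mass_ge0.
Qed.

(** Enforces [B] only during the first [n] steps, which makes backward induction possible. *)
Let truncate B n : seq S -> S -> pred S := fun h s t => (n <= size h)%N || B h s t.

(** Continuity of the measure from above: the truncated events decrease to the full one. *)
Lemma safe_mass_truncate B h s x :
  (forall n, x <= safe_mass (truncate B n) h s) -> x <= safe_mass B h s.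
Proof.
move=> xB; pose F n := cylinder s0 (rcons h s) `&` safe s0 (truncate B n) (size h).
have FB : cylinder s0 (rcons h s) `&` safe s0 B (size h) = \bigcap_n F n.
  apply/seteqP; split => r.
    by move=> [rc rs] n _; split => // i hi; rewrite /truncate rs// orbT.
  move=> rF; split => [|i hi]; first by have [] := rF 0%N I.
  (* The condition at time [i] is already enforced by the truncation at [i.+1]. *)
  have [_ /(_ i hi)] := rF i.+1 I.
  by rewrite /truncate size_mkseq ltnn.
rewrite -lee_fin prE; last exact: measurable_cylinder_safe.
rewrite FB; have mF n : measurable (F n : set (path_space s0)).
  exact: measurable_cylinder_safe.
have mI : measurable (\bigcap_n F n : set (path_space s0)).
  by apply: bigcapT_measurable.
have nF : nonincreasing_seq F.
  move=> m n mn; apply/subsetPset => r [rc rs]; split => // i hi.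
  have := rs i hi; rewrite /truncate; case/orP => [ni|->]; last by rewrite orbT.
  by rewrite (leq_trans mn ni).
have cF : run_prob sigma s0 \o F @ \oo --> run_prob sigma s0 (\bigcap_n F n).
  apply: nonincreasing_cvg_mu => //; exact: (le_lt_trans (probability_le1 _ (mF 0%N)) (ltry _)).
rewrite -(cvg_lim _ cF)//; apply: lime_ge; first by apply/cvg_ex; eexists; exact: cF.
by apply: nearW => n /=; rewrite -prE// lee_fin; exact: xB.
Qed.

(* [v] is subharmonic up to the increments of [psi], which acts as a budget for
   the total loss; no limit of [v] along runs is needed, since [v <= 1] bounds it
   by the probability of being safe for zero steps. *)
Lemma safe_prob_ge B (v psi : seq S -> S -> R) :
  (forall h s, 0 <= v h s <= 1) -> (forall h, nonneg_bounded (psi h)) ->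
  (forall h s, sorted (step M) (rcons h s) ->
     v h s + mean (next h s) (psi (rcons h s)) <=
     psi h s + mean (next h s) (fun t => if B h s t then v (rcons h s) t else 0)) ->
  v [::] s0 <= pr sigma (safe s0 B 0) + psi [::] s0.
Proof.
move=> v01 bpsi sub.
have bv h : nonneg_bounded (v h) by exists 1.
have psi0 h s : 0 <= psi h s by have [C pC] := bpsi h; have /andP[] := pC s.
(* Backward induction on the number [n - size h] of steps still enforced. At the horizon the
   truncated event is the whole cylinder, and [v <= 1] suffices. *)
have H n h s : mass (rcons h s) * v h s <=
    safe_mass (truncate B n) h s + mass (rcons h s) * psi h s.
  move Ed : (n - size h)%N => d; elim: d h s Ed => [|d IH] h s Ed.
    have -> : safe_mass (truncate B n) h s = mass (rcons h s).
      congr pr; apply/seteqP; split => [r []//|r rc]; split => // i hi.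
      by rewrite /truncate size_mkseq (leq_trans _ hi)// -subn_eq0 Ed.
    have := v01 h s; have := psi0 h s; have := mass_ge0 sigma s0 (rcons h s); nra.
  have [m0|m0] := eqVneq (mass (rcons h s)) 0.
    by rewrite m0 !mul0r addr0 safe_mass_ge0.
  have hs : sorted (step M) (rcons h s).
    by move: m0; case: (h) => //= x h' /mass_sorted[].
  have wn := is_distr_weight (mass_next_distr m0).
  (* The induction hypothesis for the successors, averaged; their [psi] serves as the error
     allowance. *)
  have L : mass (rcons h s) *
      mean (next h s) (fun t => if truncate B n h s t then v (rcons h s) t else 0) <=
      safe_mass (truncate B n) h s + mass (rcons h s) * mean (next h s) (psi (rcons h s)).
    by apply: safe_mass_lower => // t _; apply: IH; rewrite size_rcons subnS Ed.
  have LB : mean (next h s) (fun t => if B h s t then v (rcons h s) t else 0) <=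
      mean (next h s) (fun t => if truncate B n h s t then v (rcons h s) t else 0).
    apply: mean_le => //; try by apply: nonneg_bounded_if => //; exact: nonneg_bounded_cst.
    move=> t _; rewrite /truncate; have /andP[v0 _] := v01 (rcons h s) t.
    by case: (B h s t); rewrite ?orbT//; case: ifP.
  have := ler_wpM2l (mass_ge0 sigma s0 (rcons h s)) (sub h s hs).
  have := ler_wpM2l (mass_ge0 sigma s0 (rcons h s)) LB.
  by rewrite !mulrDr; lra.
rewrite -lerBlDr; apply: le_trans (_ : safe_mass B [::] s0 <= _); last first.
  apply: pr_le; [exact: measurable_cylinder_safe|exact: measurable_safe|].
  exact: subIsetr.
apply: safe_mass_truncate => n; rewrite lerBlDr.
by have := H n [::] s0; rewrite mass_start !mul1r.
Qed.

End Potential.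

Lemma pr_le_ae (R : realType) (S : countType) (M : mdp R S) (sigma : strategy M)
    (s0 : S) (A A' : set (path_space s0)) : measurable A -> measurable A' ->
  {ae run_prob sigma s0, forall r, A r -> A' r} -> pr sigma A <= pr sigma A'.
Proof.
move=> mA mA' AA'.
have mD : measurable (A `\` A') by exact: measurableD.
have N0 : run_prob sigma s0 (A `\` A') = 0%E.
  apply/negligibleP => //; apply: negligibleS AA' => r [Ar nA'r] /= H.
  exact/nA'r/H.
rewrite -lee_fin !prE// -[leRHS]adde0 -N0.
apply: le_trans (measureU2 _ _ _) => //.
apply: le_measure; rewrite ?inE//; first exact: measurableU.
by move=> r Ar; have [A'r|nA'r] := pselect (A' r); [left|right].
Qed.

(** * Near-optimal strategies for safety objectives *)

Section Clock.
Context (R : realType) (S : countType) (M : mdp R S) (s0 : S) (nx : nat -> nat).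

(** Treats both cases at once: [nx := succn] makes the clock the time and yields Markov strategies,
    [nx := id] keeps it at 0 and yields memoryless ones. *)
Definition clock n := iter n nx 0%N.

Definition clocked (B : nat -> S -> pred S) : seq S -> S -> pred S :=
  fun h => B (clock (size h)).

Section Value.
Context (sigma : strategy M) (B : nat -> S -> pred S).

(* When the mass vanishes, the quotient is [0]. *)
Let ratio s h := safe_mass sigma s0 (clocked B) h s / mass sigma s0 (rcons h s).

(** Adjoining 0 keeps the set nonempty when the clock never shows [k]. *)
Definition safe_value k s : R :=
  sup ([set 0] `|` [set ratio s h | h in [set h | clock (size h) = k]]).

Let ratio01 s h : 0 <= ratio s h <= 1.
Proof.
rewrite /ratio; have m0 := mass_ge0 sigma s0 (rcons h s).
have sm := safe_mass_le sigma s0 (clocked B) h s.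
rewrite divr_ge0 ?safe_mass_ge0//=.
have [->|n0] := eqVneq (mass sigma s0 (rcons h s)) 0; first by rewrite invr0 mulr0 ler01.
by rewrite ler_pdivrMr ?mul1r// lt_def n0.
Qed.

Let ratio_ub k s : has_ubound ([set 0] `|` [set ratio s h | h in [set h | clock (size h) = k]]).
Proof. by exists 1 => _ [->|[h _ <-]]; [exact: ler01|have /andP[] := ratio01 s h]. Qed.

Lemma safe_value_le k s x : 0 <= x ->
  (forall h, clock (size h) = k -> mass sigma s0 (rcons h s) != 0 ->
     safe_mass sigma s0 (clocked B) h s <= mass sigma s0 (rcons h s) * x) ->
  safe_value k s <= x.
Proof.
move=> x0 H; apply: ge_sup; first by exists 0; left.
move=> _ [->//|[h /= hk <-]]; rewrite /ratio.
have [->|n0] := eqVneq (mass sigma s0 (rcons h s)) 0; first by rewrite invr0 mulr0.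
by rewrite ler_pdivrMr ?lt_def ?n0 ?mass_ge0// mulrC H.
Qed.

Lemma safe_value01 k s : 0 <= safe_value k s <= 1.
Proof.
apply/andP; split; first by apply: ub_le_sup => //; left.
by apply: safe_value_le => // h _ _; rewrite mulr1 safe_mass_le.
Qed.

Lemma safe_mass_value h s : safe_mass sigma s0 (clocked B) h s <=
  mass sigma s0 (rcons h s) * safe_value (clock (size h)) s.
Proof.
have [m0|n0] := eqVneq (mass sigma s0 (rcons h s)) 0.
  by rewrite m0 mul0r -m0 safe_mass_le.
rewrite mulrC -ler_pdivrMr; last by rewrite lt_def n0 mass_ge0.
by apply: ub_le_sup => //; right; exists h.
Qed.

(** Almost every run starts in [s0], so restricting to the cylinder of [s0] costs nothing. *)
Lemma safe_value_start : pr sigma (safe s0 (clocked B) 0) <= safe_value 0 s0.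
Proof.
apply: le_trans (_ : safe_mass sigma s0 (clocked B) [::] s0 <= _); last first.
  by have := safe_mass_value [::] s0; rewrite mass_start mul1r.
apply: pr_le_ae; [exact: measurable_safe|exact: measurable_cylinder_safe|].
apply: negligibleS (run_prob_runs sigma s0) => r nr [r0 _]; apply: nr => rs; split => //.
by rewrite /cylinder/= /mkseq/= r0.
Qed.

Let gain k s t := if B k s t then safe_value (nx k) t else 0.

Let gain_bounded k s : nonneg_bounded (gain k s).
Proof.
apply: (nonneg_bounded_if (B k s)); last exact: nonneg_bounded_cst.
by exists 1 => t; exact: safe_value01.
Qed.

Let safe_mass_gain h s : safe_mass sigma s0 (clocked B) h s <=
  mass sigma s0 (rcons h s) * mean (next_prob sigma h s) (gain (clock (size h)) s).
Proof.
apply: (@safe_mass_upper _ _ _ _ _ _ _ _ (safe_value (nx (clock (size h))))).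
  by exists 1 => t; exact: safe_value01.
by move=> t; have := safe_mass_value (rcons h s) t; rewrite size_rcons.
Qed.

Lemma safe_value_random k s : ~~ controlled M s ->
  safe_value k s <= mean (prob M s) (gain k s).
Proof.
move=> cs; apply: safe_value_le.
  by apply: mean_ge0 => //; exact: is_distr_weight (probP cs).
move=> h hk _; have := safe_mass_gain h s.
by rewrite hk (_ : next_prob sigma h s = prob M s)// /next_prob (negbTE cs).
Qed.

(** If every successor fell short by more than [e], every average over successors would be at most
    [safe_value k s - e], which would then bound all the ratios and contradict the supremum. *)
Lemma safe_value_controlled k s e : 0 < e ->
  exists t, step M s t /\ safe_value k s <= gain k s t + e.
Proof.
move=> e0; apply: contrapT => H; have [t0 st0] := step_total M s.
have G t : step M s t -> gain k s t <= safe_value k s - e.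
  move=> st; rewrite leNgt; apply/negP => lt; apply: H; exists t; split => //.
  by move: lt; lra.
have g0 : 0 <= gain k s t0 by have [C /(_ t0)/andP[]] := gain_bounded k s.
have : safe_value k s <= safe_value k s - e.
  (* Required because 0 is adjoined in [safe_value]; totality of [step] supplies the successor
     [t0]. *)
  have x0 : 0 <= safe_value k s - e by exact: le_trans (G _ st0).
  apply: safe_value_le => // h hk m0.
  apply: le_trans (safe_mass_gain h s) _; rewrite ler_wpM2l ?mass_ge0//.
  by apply: mean_le_cst (mass_next_distr m0) _ _ _ => //; rewrite hk.
by lra.
Qed.

End Value.

Definition clock_strategy (sigma : strategy M) := exists f : nat -> S -> S,
  forall h s t, is_history M h s -> sigma h s t = (t == f (clock (size h)) s)%:R.

Lemma clock_strategy_of (f : nat -> S -> S) : (forall k s, step M s (f k s)) ->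
  exists tau : strategy M, forall h s, play tau h s = fun t => (t == f (clock (size h)) s)%:R.
Proof.
move=> fs; pose p (h : seq S) s := fun t => (t == f (clock (size h)) s)%:R : R.
have pP h s : is_history M h s -> is_distr (step M s) (p h s).
  by move=> _; exact: is_distr_dirac.
by exists (Strategy pP).
Qed.

(** [tau] plays at each controlled state a successor losing at most [loss] of the value, and [psi]
    pays for all losses. Clock and state suffice for the choice, as [safe_value] depends on nothing
    else. *)
Lemma clock_safety (sigma : strategy M) (B : nat -> S -> pred S)
    (loss psi : nat -> S -> R) :
  (forall k s, 0 < loss k s) -> (forall k, nonneg_bounded (psi k)) ->
  (forall k s t, controlled M s -> step M s t -> psi (nx k) t + loss k s <= psi k s) ->
  (forall k s, ~~ controlled M s -> mean (prob M s) (psi (nx k)) <= psi k s) ->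
  exists tau : strategy M, clock_strategy tau /\
    pr sigma (safe s0 (clocked B) 0) <= pr tau (safe s0 (clocked B) 0) + psi 0%N s0.
Proof.
move=> l0 bpsi psic psir; pose v := safe_value sigma B.
have /choice[f fP] : forall ks : nat * S, exists t, step M ks.2 t /\
    v ks.1 ks.2 <= (if B ks.1 ks.2 t then v (nx ks.1) t else 0) + loss ks.1 ks.2.
  by move=> [k s]; exact: safe_value_controlled.
have [tau tauE] := @clock_strategy_of (fun k s => f (k, s)) (fun k s => (fP (k, s)).1).
exists tau; split; first by exists (fun k s => f (k, s)) => h s t _; rewrite tauE.
apply: le_trans (safe_value_start sigma B) _.
apply: (@safe_prob_ge _ _ _ tau s0 (clocked B) (fun h => v (clock (size h)))
  (fun h => psi (clock (size h)))) => [h s|h|h s hs] /=.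
- exact: safe_value01.
- exact: bpsi.
rewrite /clocked !size_rcons /= /next_prob; set k := clock (size h).
have [cs|cs] := boolP (controlled M s); last first.
  have := psir k s cs; have := safe_value_random sigma B k cs; rewrite -/v.
  by lra.
rewrite tauE -/k !mean_dirac//; last first.
  apply: nonneg_bounded_if; last exact: nonneg_bounded_cst.
  by exists 1 => t; exact: safe_value01.
have [/= st vle] := fP (k, s); have := psic k s _ cs st.
by move: vle; lra.
Qed.

End Clock.

(** * Reduction of the objective to safety *)

Section Reduction.
Context (R : realType) (S : countType) (M : mdp R S) (s0 : S).

Lemma measurable_FG (A : set (S * S)) :
  measurable (FG M A : set (path_space s0)).
Proof.
rewrite (_ : FG M A = (\bigcap_n [set r | step M (r n) (r n.+1)]) `&`
   \bigcup_N \bigcap_n [set r | (N <= n)%N -> A (r n, r n.+1)]).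
  apply: measurableI.
    apply: bigcapT_measurable => n.
    exact: (@measurable_step _ s0 n (fun s t => step M s t)).
  apply: bigcupT_measurable => N; apply: bigcapT_measurable => n.
  exact: (@measurable_step _ s0 n (fun s t => (N <= n)%N -> A (s, t))).
apply/seteqP; split => r.
  by move=> [rr [N rN]]; split => [n _|]; [exact: rr|exists N => // n _; exact: rN].
move=> [rr [N _ rN]]; split => [n|]; first exact: rr.
by exists N => n; exact: rN.
Qed.

Lemma strategy_exists : exists sigma : strategy M, True.
Proof.
have /choice[f fP] := step_total M.
by have [sigma _] := @clock_strategy_of _ _ M id (fun=> f) (fun=> fP); exists sigma.
Qed.

Lemma value_fin_num phi : measurable (phi : set (path_space s0)) ->
  value M s0 phi \is a fin_num.
Proof.
move=> mphi; rewrite ge0_fin_numE.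
  apply: le_lt_trans (ltry 1); apply: ge_ereal_sup => _ [sigma _ <-].
  exact: probability_le1.
have [sigma _] := strategy_exists.
apply: (@le_trans _ _ (run_prob sigma s0 phi)); first exact: measure_ge0.
by apply: ereal_sup_ubound; exists sigma.
Qed.

Lemma null_limit (sigma : strategy M) (F : nat -> set (path_space s0)) (e : R) :
  0 < e -> (forall n, measurable (F n)) -> nonincreasing_seq F ->
  \bigcap_n F n = set0 -> exists n, (run_prob sigma s0 (F n) <= e%:E)%E.
Proof.
move=> e0 mF nF F0.
have mI : measurable (\bigcap_n F n) by exact: bigcapT_measurable.
have cF : run_prob sigma s0 \o F @ \oo --> run_prob sigma s0 (\bigcap_n F n).
  apply: nonincreasing_cvg_mu => //.
  exact: (le_lt_trans (probability_le1 _ (mF 0%N)) (ltry _)).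
move: cF; rewrite F0 measure0 => /fine_cvgP[_ cF].
have /cvgr_lt/(_ _ e0) := cF.
move=> [n _ /(_ n (leqnn _))] /= Fn; exists n.
by rewrite -prE// lee_fin; exact: ltW.
Qed.

Context (nx : nat -> nat) (c : nat -> S -> nat) (A : nat -> set (S * S)).

Let phi : set (path_space s0) := \bigcap_i FG M (A i).

(* [c] tends to infinity along almost every run, so being safe for [allowed N]
   forces the transitions into every [A i] from some step on. *)
Let allowed (N : nat -> nat) (k : nat) (s t : S) : bool :=
  `[< forall i, (c k s < N i)%N \/ A i (s, t) >].

Let safe_until i N : set (path_space s0) :=
  [set r | forall n, (c (clock nx n) (r n) < N)%N \/ A i (r n, r n.+1)].

Let measurable_safe_until i N : measurable (safe_until i N).
Proof.
rewrite (_ : safe_until i N =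
   \bigcap_n [set r | (c (clock nx n) (r n) < N)%N \/ A i (r n, r n.+1)]).
  apply: bigcapT_measurable => n.
  exact: (@measurable_step _ s0 n (fun s t => (c (clock nx n) s < N)%N \/ A i (s, t))).
by apply/seteqP; split => r H n; [move=> _|]; exact: H.
Qed.

Let measurable_phi : measurable (phi : set (path_space s0)).
Proof. by apply: bigcapT_measurable => i; exact: measurable_FG. Qed.

(** A union bound over [i], with the share [e / 2^(i+1)] for the winning runs that violate the
    [i]-th condition. *)
Lemma clock_reduction (sigma : strategy M) (e : R) : 0 < e ->
  exists N, pr sigma phi <= pr sigma (safe s0 (clocked nx (allowed N)) 0) + e.
Proof.
move=> e0; have /choice[N NP] : forall i, exists n,
    (run_prob sigma s0 (phi `\` safe_until i n) <= (e / (2 ^ i.+1)%:R)%:E)%E.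
  move=> i; apply: null_limit.
  - by rewrite divr_gt0// ltr0n expn_gt0.
  - by move=> n; exact: measurableD.
  - move=> m n mn; apply/subsetPset => r [pr nr]; split => // ru; apply: nr => k.
    by have [lt|] := ru k; [left; exact: leq_trans lt mn|right].
  apply/seteqP; split => // r rP.
  (* A run in all the differences takes transitions of [A i] from some [m] on. Once [b] exceeds the
     values of [c] before [m], the run lies in [safe_until i b], a contradiction. *)
  have [rphi _] := rP 0%N I; have [_ [m rm]] := rphi i I.
  have [b bP] : exists b, forall n, (n < m)%N -> (c (clock nx n) (r n) < b)%N.
    exists (\max_(n < m) c (clock nx n) (r n)).+1 => n nm; rewrite ltnS.
    exact: (@leq_bigmax _ (fun n : 'I_m => c (clock nx n) (r n)) (Ordinal nm)).
  have [_ []] := rP b I; move=> n; have [nm|mn] := ltnP n m; first by left; exact: bP.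
  by right; exact: rm.
exists N; set B := safe _ _ _; have mB : measurable B by exact: measurable_safe.
rewrite -lee_fin EFinD !prE//.
have mD i : measurable (phi `\` safe_until i (N i)) by exact: measurableD.
have sub : phi `<=` B `|` \bigcup_i (phi `\` safe_until i (N i)).
  move=> r rphi; have [rB|nrB] := pselect (B r); first by left.
  right; apply: contrapT => nU; apply: nrB => n _; apply/asboolP => i.
  rewrite size_mkseq; suff ru : safe_until i (N i) r by exact: ru.
  by apply: contrapT => nr; apply: nU; exists i.
have mU : measurable (\bigcup_i (phi `\` safe_until i (N i))) by exact: bigcupT_measurable.
apply: (@le_trans _ _ (run_prob sigma s0 (B `|` \bigcup_i (phi `\` safe_until i (N i))))).
  by apply: le_measure; rewrite ?inE//; exact: measurableU.
apply: (le_trans (measureU2 _ _ _)) => //; rewrite leeD2l//.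
apply: le_trans (epsilon_trick0 xpredT (ltW e0)).
apply: (@le_trans _ _ (\sum_(i <oo) run_prob sigma s0 (phi `\` safe_until i (N i)))%E).
  exact: (measure_sigma_subadditive _ mD mU).
by apply: lee_nneseries => // i _; exact: NP.
Qed.

Lemma allowed_phi (tau : strategy M) N :
  {ae run_prob tau s0, forall r b, exists m, forall n, (m <= n)%N ->
     (b <= c (clock nx n) (r n))%N} ->
  pr tau (safe s0 (clocked nx (allowed N)) 0) <= pr tau phi.
Proof.
move=> esc; apply: pr_le_ae => //; first exact: measurable_safe.
apply: negligibleS (negligibleU esc (run_prob_runs tau s0)) => r /= nr.
apply: contrapT => /not_orP[/contrapT er /contrapT[_ rr]]; apply: nr => rs i _.
(* From [m] on the value of [c] is at least [N i], which leaves only the second alternative of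
   [allowed]. *)
split => //; have [m rm] := er (N i); exists m => n mn.
have := rs n (leq0n _); rewrite /clocked size_mkseq => /asboolP/(_ i)[|//].
by rewrite ltnNge rm.
Qed.

(** The error is [eps / 4] for a near-optimal [sigma], [eps / 4] for the reduction to safety and at
    most [eps / 2] for [psi] at the start. *)
Lemma clock_optimal (eps : R) (loss psi : nat -> S -> R) : 0 < eps ->
  (forall k s, 0 < loss k s) -> (forall k, nonneg_bounded (psi k)) ->
  (forall k s t, controlled M s -> step M s t -> psi (nx k) t + loss k s <= psi k s) ->
  (forall k s, ~~ controlled M s -> mean (prob M s) (psi (nx k)) <= psi k s) ->
  psi 0%N s0 <= eps / 2 ->
  (forall tau : strategy M, {ae run_prob tau s0, forall r b, exists m,
     forall n, (m <= n)%N -> (b <= c (clock nx n) (r n))%N}) ->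
  exists tau : strategy M, clock_strategy nx tau /\ eps_optimal eps s0 phi tau.
Proof.
move=> eps0 l0 bpsi psic psir psi0 esc.
have [|_ [sigma _ <-] sigmaP] := @ub_ereal_sup_adherent R
  [set run_prob sigma s0 phi | sigma in [set: strategy M]] (eps / 4) _
  (value_fin_num measurable_phi).
  by lra.
have [|N NP] := @clock_reduction sigma (eps / 4); first by lra.
have [tau [ctau tauP]] := clock_safety s0 sigma (allowed N) l0 bpsi psic psir.
exists tau; split => //; rewrite /eps_optimal.
have := value_fin_num measurable_phi; move: sigmaP; rewrite -/(value M s0 phi).
case: (value M s0 phi) => // x; rewrite -!prE// lte_fin lee_fin => xs _.
by have := allowed_phi N (esc tau); lra.
Qed.

End Reduction.

(** * Optimal probabilities of reaching a state *)

Section Return.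
Context (R : realType) (S : countType) (M : mdp R S) (x : S).

(** Turns the value of a later visit to [x] into that of a visit now or later. *)
Definition hit (f : S -> R) (t : S) : R := if t == x then 1 else f t.

(* The optimal probability of visiting [x] within the next [n] steps, the
   present visit not being counted. *)
Fixpoint reach (n : nat) (s : S) : R :=
  if n is k.+1 then
    if controlled M s then sup [set hit (reach k) t | t in [set t | step M s t]]
    else mean (prob M s) (hit (reach k))
  else 0.

(** As [reach] increases in [n], this is its limit: the optimal probability of a later visit to [x]
    without a time bound. *)
Definition reach_lim (s : S) : R := sup (range (reach ^~ s)).

Lemma hit01 f : (forall t, 0 <= f t <= 1) -> forall t, 0 <= hit f t <= 1.
Proof. by move=> f01 t; rewrite /hit; case: ifP => _; rewrite ?f01// ler01 lexx. Qed.

Let successors_sup (f : S -> R) s : (forall t, 0 <= f t <= 1) ->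
  has_sup [set f t | t in [set t | step M s t]].
Proof.
move=> f01; split; first by have [t st] := step_total M s; exists (f t), t.
by exists 1 => _ [t _ <-]; have /andP[] := f01 t.
Qed.

Lemma reach01 n s : 0 <= reach n s <= 1.
Proof.
elim: n s => [|n IH] s /=; first by rewrite lexx ler01.
have g01 := hit01 IH; have gb : nonneg_bounded (hit (reach n)) by exists 1.
case: ifPn => cs; last first.
  rewrite mean_ge0//=; last exact: is_distr_weight (probP cs).
  by apply: mean_le_cst (probP cs) _ _ _ => // t _; have /andP[] := g01 t.
have [ne ub] := successors_sup s g01; have [t st] := step_total M s.
apply/andP; split; last by apply: ge_sup => // _ [u _ <-]; have /andP[] := g01 u.
apply: (@le_trans _ _ (hit (reach n) t)); first by have /andP[] := g01 t.
by apply: ub_le_sup => //; exists t.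
Qed.

Let hit_bounded n : nonneg_bounded (hit (reach n)).
Proof. by exists 1; apply: hit01 => t; exact: reach01. Qed.

Lemma reach_step n s t : controlled M s -> step M s t -> hit (reach n) t <= reach n.+1 s.
Proof.
move=> cs st /=; rewrite cs; apply: ub_le_sup; last by exists t.
by apply: (successors_sup s (hit01 (reach01 n))).2.
Qed.

Lemma reach_adherent n s e : 0 < e -> controlled M s ->
  exists t, step M s t /\ reach n.+1 s <= hit (reach n) t + e.
Proof.
move=> e0 cs /=; rewrite cs.
have [_ [t st <-]] := sup_adherent e0 (successors_sup s (hit01 (reach01 n))).
by move=> lt; exists t; split => //; move: lt; lra.
Qed.

Lemma reach_leS n s : reach n s <= reach n.+1 s.
Proof.
elim: n s => [|n IH] s; first by have /andP[] := reach01 1 s.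
have hIH t : hit (reach n) t <= hit (reach n.+1) t by rewrite /hit; case: ifP.
have [cs|cs] := boolP (controlled M s); last first.
  rewrite /= (negbTE cs); apply: mean_le => //.
    exact: is_distr_weight (probP cs).
  exact: (hit_bounded n.+1).
rewrite [reach n.+1 s]/= cs; apply: ge_sup; first exact: (successors_sup s (hit01 (reach01 n))).1.
by move=> _ [t st <-]; apply: le_trans (hIH t) (reach_step _ cs st).
Qed.

Lemma reach_mono m n s : (m <= n)%N -> reach m s <= reach n s.
Proof.
move=> /subnKC <-; elim: (n - m)%N => [|d IH]; first by rewrite addn0.
by rewrite addnS (le_trans IH)// reach_leS.
Qed.

Let reach_lim_sup s : has_sup (range (reach ^~ s)).
Proof. by split; [exists 0, 0%N|exists 1 => _ [n _ <-]; have /andP[] := reach01 n s]. Qed.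

Lemma reach_le_lim n s : reach n s <= reach_lim s.
Proof. by apply: ub_le_sup; [exact: (reach_lim_sup s).2|exists n]. Qed.

Lemma reach_lim01 s : 0 <= reach_lim s <= 1.
Proof.
apply/andP; split; first exact: (reach_le_lim 0).
apply: ge_sup; first exact: (reach_lim_sup s).1.
by move=> _ [n _ <-]; have /andP[] := reach01 n s.
Qed.

Lemma reach_lim_adherent s e : 0 < e -> exists n, reach_lim s <= reach n s + e.
Proof.
move=> e0; have [_ [n _ <-] lt] := sup_adherent e0 (reach_lim_sup s).
by exists n; move: lt; rewrite -/(reach_lim s); lra.
Qed.

Lemma reach_lim_step s t : controlled M s -> step M s t -> hit reach_lim t <= reach_lim s.
Proof.
move=> cs st; have := reach_step _ cs st; rewrite /hit; case: ifP => _ H.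
  exact: le_trans (H 0%N) (reach_le_lim _ _).
apply: ge_sup; first exact: (reach_lim_sup t).1.
by move=> _ [n _ <-]; apply: le_trans (H n) (reach_le_lim _ _).
Qed.

(* Monotone convergence, by approximating finitely many terms at once. *)
Lemma reach_lim_mean s : ~~ controlled M s ->
  mean (prob M s) (hit reach_lim) <= reach_lim s.
Proof.
move=> cs; have wp := is_distr_weight (probP cs); have [p0 _ p1] := probP cs.
have b : nonneg_bounded (hit reach_lim) by exists 1; apply: hit01 => t; exact: reach_lim01.
rewrite -lee_fin meanE//; apply: ge_ereal_sup => _ [X [finX _] <-].
apply/lee_addgt0Pr => e e0.
have /choice[N NP] : forall t, exists n, reach_lim t <= reach n t + e.
  by move=> t; exact: reach_lim_adherent.
have /finite_seqP[q Xq] := finX; pose n := (\max_(t <- q) N t)%N.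
have nP t : X t -> hit reach_lim t <= hit (reach n) t + e.
  move=> Xt; rewrite /hit; case: ifP => _; first by rewrite lerDl ltW.
  apply: le_trans (NP t) _; rewrite lerD2r; apply: reach_mono.
  by rewrite /n; apply: (@leq_bigmax_seq _ _ xpredT) => //; rewrite Xq in Xt.
have term0 t : (0 <= (prob M s t * (hit (reach n) t + e))%:E)%E.
  by rewrite lee_fin mulr_ge0//; have := hit01 (reach01 n) t; lra.
apply: (@le_trans _ _ (\esum_(t in X) (prob M s t * (hit (reach n) t + e))%:E)%E).
  rewrite esum_fset//.
  apply: (lee_fsum finX) => t Xt; rewrite lee_fin ler_wpM2l//; exact: nP.
apply: (@le_trans _ _ (mean (prob M s) (fun t => hit (reach n) t + e))%:E).
  rewrite meanE//; last by apply: nonneg_boundedD => //; exact: nonneg_bounded_cst (ltW e0).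
  rewrite esum_mkcond; apply: le_esum => t _; case: ifP => // _; exact: term0.
rewrite meanD//; last exact: nonneg_bounded_cst (ltW e0).
rewrite (mean_cst (probP cs) (ltW e0)) -EFinD lee_fin lerD2r.
by have := reach_le_lim n.+1 s; rewrite /= (negbTE cs).
Qed.

End Return.

(** * Consequences of universal transience *)

Section Budget.
Context (S : countType) (x : S) (N : nat -> nat).

Fixpoint budget_rev (q : seq S) : nat :=
  if q is s :: q' then if s == x then N (size q') else (budget_rev q').-1 else 0%N.

(* At a visit of [x] at time [n] the budget is reset to [N n]; otherwise each
   step costs one unit. *)
Definition budget p := budget_rev (rev p).

Lemma budget_rcons h s :
  budget (rcons h s) = if s == x then N (size h) else (budget h).-1.
Proof. by rewrite /budget rev_rcons /= size_rev. Qed.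

(** After a last visit to [x] the budget would shrink by one in each step and reach 0. *)
Lemma budget_infinitely_often (r : nat -> S) :
  (forall n, 0 < budget (mkseq r n.+1))%N -> infinitely_often x r.
Proof.
move=> b0 n0; apply: contrapT => H.
have nx k : (n0 <= k)%N -> (r k == x) = false.
  by move=> nk; apply/eqP => rk; apply: H; exists k.
have D d : (budget (mkseq r (n0 + d)) <= budget (mkseq r n0) - d)%N.
  elim: d => [|d IH]; first by rewrite addn0 subn0.
  by rewrite addnS mkseq_rcons budget_rcons nx ?leq_addr// subnS -!subn1 leq_sub2r.
have := b0 (n0 + budget (mkseq r n0))%N.
rewrite mkseq_rcons budget_rcons nx ?leq_addr//.
by have := D (budget (mkseq r n0)); rewrite subnn leqn0 => /eqP ->.
Qed.

End Budget.

(* If almost sure returns could be approximated, one could play for a return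
   within a finite budget, over and over, failing with total probability at most
   3/4, and visit [x] infinitely often. *)
Lemma return_lt1 (R : realType) (S : countType) (M : mdp R S) (x : S) :
  universally_transient M -> reach_lim M x x < 1.
Proof.
move=> trans; rewrite ltNge; apply/negP => r1.
have [a [a0 aS a1]] : exists a : nat -> R,
    [/\ forall n, 0 < a n, forall n, a n = 2 * a n.+1 & a 0%N = 1].
  exists (fun n => 2^-1 ^+ n); split => // n.
  by rewrite exprS mulrA divff// mul1r.
(* After a visit at time [n], a budget of [N n] steps allows a return with optimal probability at
   least [1 - 2^-(n+2)], since the limit is at least 1 by [r1]. *)
have /choice[N NP] n : exists k, 1 - a n.+2 <= reach M x k x.
  have [k kP] := reach_lim_adherent M x x (a0 n.+2).
  by exists k; move: r1 kP; lra.
(* The arguments are the time, the budget left after the step and the state; the choice at time [n]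
   loses at most [a n.+3]. *)
have /choice[f fP] : forall nks : nat * nat * S, exists t, step M nks.2 t /\
    (controlled M nks.2 -> reach M x nks.1.2.+1 nks.2 <=
       hit x (reach M x nks.1.2) t + a nks.1.1.+3).
  move=> [[n k] s]; have [cs|ncs] := pselect (controlled M s).
  have [t [st tP]] := reach_adherent x k (a0 n.+3) cs.
    by exists t; split => // _; exact: tP.
  by have [t st] := step_total M s; exists t; split.
(* Safety means that the budget never runs out, which forces infinitely many visits to [x]. *)
pose B (h : seq S) s (t : S) := (0 < budget x N (rcons h s))%N.
pose p (h : seq S) s := fun t =>
  (t == f (size h, (budget x N (rcons h s)).-1, s))%:R : R.
have pP h s : is_history M h s -> is_distr (step M s) (p h s).
  by move=> _; apply: is_distr_dirac; have [] := fP (size h, (budget x N (rcons h s)).-1, s).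
pose tau := Strategy pP.
(* Here [v] is the optimal probability of a return within the current budget. At time [n] the
   potential drops from [a n.+1] to [a n.+2], which pays for two losses of [a n.+3]: the choice of
   the successor and the budget reset at [x]. *)
have : reach M x (budget x N [:: x]) x <= pr tau (safe x B 0) + a 1%N.
  apply: (@safe_prob_ge _ _ _ tau x B (fun h s => reach M x (budget x N (rcons h s)) s)
    (fun h _ => a (size h).+1)) => [h s|h|h s hs] /=.
  - exact: reach01.
  - by apply: nonneg_bounded_cst; exact: ltW.
  have nd := next_probP tau hs; have wn := is_distr_weight nd.
  rewrite (mean_cst nd (ltW (a0 _))) size_rcons.
  set b := budget x N (rcons h s).
  have b01 : nonneg_bounded (fun t => reach M x (budget x N (rcons (rcons h s) t)) t).
    by exists 1 => t; exact: reach01.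
  case Eb : b => [|k].
    have : 0 <= mean (next_prob tau h s) (fun t => if B h s t then
        reach M x (budget x N (rcons (rcons h s) t)) t else 0).
      by apply: mean_ge0 => //; apply: nonneg_bounded_if => //; exact: nonneg_bounded_cst.
    by have := aS (size h).+1; have := a0 (size h).+2; rewrite [reach M x 0 s]/=; lra.
  have -> : mean (next_prob tau h s) (fun t => if B h s t then
        reach M x (budget x N (rcons (rcons h s) t)) t else 0) =
      mean (next_prob tau h s) (fun t => reach M x (budget x N (rcons (rcons h s) t)) t).
    by apply: eq_mean => t _; rewrite /B -/b Eb.
  have hv t : hit x (reach M x k) t <=
      reach M x (budget x N (rcons (rcons h s) t)) t + a (size h).+3.
    rewrite budget_rcons -/b Eb size_rcons /hit; case: eqP => [->|_] /=.
      by have := NP (size h).+1; lra.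
    by rewrite lerDl ltW.
  suff : reach M x k.+1 s <= mean (next_prob tau h s)
      (fun t => reach M x (budget x N (rcons (rcons h s) t)) t) + a (size h).+3 *+ 2.
    by rewrite mulr2n; have := aS (size h).+1; have := aS (size h).+2; lra.
  have [cs|cs] := boolP (controlled M s).
    rewrite /next_prob cs [play tau h s]/= /p -/b Eb mean_dirac//=.
    have [_ /(_ cs)] := fP (size h, k, s); have := hv (f (size h, k, s)).
    by rewrite mulr2n /=; lra.
  have np : next_prob tau h s = prob M s by rewrite /next_prob (negbTE cs).
  rewrite /= (negbTE cs) np.
  rewrite np in wn nd.
  apply: (@le_trans _ _ (mean (prob M s)
      (fun t => reach M x (budget x N (rcons (rcons h s) t)) t + a (size h).+3))).
    apply: mean_le => //.
    - by exists 1; apply: hit01; exact: reach01.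
    - by apply: nonneg_boundedD => //; apply: nonneg_bounded_cst; exact: ltW.
  rewrite meanD//; last by apply: nonneg_bounded_cst; exact: ltW.
  by rewrite (mean_cst nd (ltW (a0 _))) mulr2n; have := a0 (size h).+3; lra.
have -> : budget x N [:: x] = N 0%N by rewrite /budget /= eqxx.
have -> : pr tau (safe x B 0) = 0.
  rewrite /pr (_ : run_prob tau x _ = 0%E)//.
  apply/negligibleP; first exact: measurable_safe.
  apply: negligibleS (trans x tau) => r rs /= /(_ x); apply.
  apply: budget_infinitely_often => n; have := rs n (leq0n _).
  by rewrite /B -mkseq_rcons; exact.
(* The left side is at least [1 - a 2 = 3/4], the right side is [a 1 = 1/2]. *)
have := NP 0%N; have := aS 0%N; have := aS 1%N; lra.
Qed.

(** [psi s] sums over [y] the weight [w y] times the optimal probability of visiting [y] now or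
    later. A step from a controlled [s] raises no term, and the term of [y = s] drops from [w s] to
    at most [w s] times the return probability, which is below 1. *)
Lemma transient_potential (R : realType) (S : countType) (M : mdp R S) (e : R) :
  0 < e -> universally_transient M -> exists loss psi : S -> R,
  [/\ forall s, 0 < loss s, forall s, 0 <= psi s <= e,
      forall s t, controlled M s -> step M s t -> psi t + loss s <= psi s &
      forall s, ~~ controlled M s -> mean (prob M s) psi <= psi s].
Proof.
move=> e0 trans; have [w [ww w0 we]] := small_weight S e0.
pose g s y : R := hit y (reach_lim M y) s.
have g01 s y : 0 <= g s y <= 1 by apply: hit01 => t; exact: reach_lim01.
have gb s : nonneg_bounded (g s) by exists 1.
have rb s : nonneg_bounded (fun y => reach_lim M y s).
  by exists 1 => y; exact: reach_lim01.
have rg s y : reach_lim M y s <= g s y.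
  by rewrite /g /hit; case: ifP => // _; have /andP[] := reach_lim01 M y s.
exists (fun s => w s * (1 - reach_lim M s s)), (fun s => mean w (g s)); split.
- by move=> s; rewrite mulr_gt0// subr_gt0 return_lt1.
- move=> s; rewrite mean_ge0//=; apply: le_trans _ we.
  apply: mean_le => //; first exact: nonneg_bounded_cst.
  by move=> y _; have /andP[] := g01 s y.
- move=> s t cs st; have l0 : 0 <= 1 - reach_lim M s s.
    by rewrite subr_ge0 ltW// return_lt1.
  have -> : mean w (g s) = mean w (fun y => reach_lim M y s +
      if y == s then 1 - reach_lim M s s else 0).
    apply: eq_mean => y _; rewrite /g /hit eq_sym.
    by case: eqP => [->|_]; rewrite ?addr0// addrC subrK.
  rewrite meanD//; last first.
    by apply: nonneg_bounded_if; exact: nonneg_bounded_cst.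
  rewrite mean_at// lerD2r; apply: mean_le => // y _; exact: reach_lim_step.
- move=> s cs; have wp := is_distr_weight (probP cs).
  rewrite (mean_exchange wp ww)//.
  apply: mean_le => //.
    exists 1 => y; have b : nonneg_bounded (g^~ y) by exists 1.
    rewrite mean_ge0//=; apply: mean_le_cst (probP cs) b ler01 _ => t _.
    by have /andP[] := g01 t y.
  by move=> y _; apply: le_trans (rg s y); exact: reach_lim_mean.
Qed.

(** Induction on [b]: the state with code [b], if there is one, is visited only finitely often. *)
Lemma transient_escape (S : countType) (r : nat -> S) :
  (forall t, ~ infinitely_often t r) ->
  forall b, exists m, forall n, (m <= n)%N -> (b <= pickle (r n))%N.
Proof.
move=> ni; elim=> [|b [m mP]]; first by exists 0%N.
have [m' m'P] : exists m', forall n, (m' <= n)%N -> pickle (r n) != b.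
  case E : (@pickle_inv S b) => [t|]; last first.
    by exists 0%N => n _; apply/eqP => nb; move: E; rewrite -nb pickleK_inv.
  apply: contrapT => H; apply: (ni t) => N; apply: contrapT => Ht; apply: H.
  exists N => n Nn; apply/eqP => nb; apply: Ht; exists n => //.
  by move: E; rewrite -nb pickleK_inv => -[].
exists (maxn m m') => n; rewrite geq_max => /andP[/mP bn /m'P nb].
by rewrite ltn_neqAle eq_sym nb bn.
Qed.

(** * The memoryless and the Markov case *)

Lemma clock_succn n : clock succn n = n. Proof. by elim: n => //= n ->. Qed.

Lemma clock_id n : clock id n = 0%N. Proof. by elim: n. Qed.

Theorem corollary27 (R : realType) (S : countType) (M : mdp R S) (s0 : S)
    (A : nat -> set (S * S)) (A_trans : forall i, A i `<=` transitions M)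
    (A_decr : forall i j, (i <= j)%N -> A j `<=` A i)
    (eps : R) (eps_gt0 : 0 < eps) :
  let phi := \bigcap_i FG M (A i) in
  (universally_transient M ->
     exists sigma : strategy M,
       [/\ memoryless_strategy sigma, deterministic_strategy sigma & eps_optimal eps s0 phi sigma])
  /\
  (exists sigma : strategy M,
     [/\ markov_strategy sigma, deterministic_strategy sigma & eps_optimal eps s0 phi sigma]).
Proof.
move=> phi.
have deterministic nx (tau : strategy M) : clock_strategy nx tau -> deterministic_strategy tau.
  by move=> [f fP] h s hs; exists (f (clock nx (size h)) s) => t; exact: fP.
have e2 : 0 < eps / 2 by rewrite divr_gt0.
split=> [trans|].
  have [loss [psi [l0 psi0 psic psir]]] := transient_potential e2 trans.
  (* The clock is frozen, so [loss] and [psi] depend on the state only; the index of a state is its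
     code, which tends to infinity along almost every run by transience. *)
  have [||||||tau [ctau tauP]] := @clock_optimal R S M s0 id (fun=> pickle) A eps
      (fun=> loss) (fun=> psi) eps_gt0.
  - by [].
  - by move=> _; exists (eps / 2).
  - by move=> _.
  - by move=> _.
  - by have /andP[] := psi0 s0.
  - move=> tau; apply: negligibleS (trans s0 tau) => r /= nr; apply: contra_not nr.
    exact: transient_escape.
  exists tau; split => //; last exact: deterministic ctau.
  have [f fP] := ctau; move=> h h' s hs hs'; apply/funext => t.
  by rewrite !fP// !clock_id.
(* Half of [psi n] pays the loss at time [n], the other half remains as [psi n.+1]. The index is the
   time itself. *)
pose psi n : R := eps / 2 * 2^-1 ^+ n.
have psi_gt0 n : 0 < psi n by rewrite mulr_gt0// exprn_gt0// invr_gt0.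
have psiS n : psi n = psi n.+1 + psi n.+1.
  by rewrite /psi exprS; field.
have [||||||tau [ctau tauP]] := @clock_optimal R S M s0 succn (fun n _ => n) A eps
    (fun n _ => psi n.+1) (fun n _ => psi n) eps_gt0.
- by [].
- by move=> n; apply: nonneg_bounded_cst; exact: ltW.
- by move=> n s t _ _; rewrite [leRHS]psiS.
- by move=> n s cs; rewrite (mean_cst (probP cs) (ltW _))// [leRHS]psiS lerDl ltW.
- by rewrite /psi expr0 mulr1.
- move=> tau; apply: aeW => r b; exists b => n; by rewrite clock_succn.
exists tau; split => //; last exact: deterministic ctau.
have [f fP] := ctau; move=> h h' s hs hs' hh; apply/funext => t.
by rewrite !fP// hh.
Qed.
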